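(* Let $p(x)$ be a partial type over a set $A$ such that for every $A'\supseteq A$ with $A'\setminus A$ finite, every $A'$-indiscernible sequence $\langle a_i\mid i<|T|^{+}+|A|^{+}\rangle$ of tuples realizing $p$, and every singleton $c$, there is $\alpha<|T|^{+}+|A|^{+}$ such that $\langle a_i\mid\alpha<i\rangle$ is indiscernible over $A'\cup\{c\}$. Then $p$ is dependent.
   Context: $T$ is a complete first-order theory with monster model $\mathfrak{C}$. For a cardinal $\kappa$, $\operatorname{rk-dp}(p)<\kappa$ means: for every $a\models p$ and every $\kappa$ sequences mutually indiscernible over $A$ (each indiscernible over $A$ together with the others), at least one is indiscernible over $A\cup\{a\}$. $p$ is dependent if $\operatorname{rk-dp}(p)<\kappa$ for some cardinal $\kappa$. *)

(* Defs.v *)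
From HB Require Import structures.
From mathcomp Require Import all_boot all_order.
From mathcomp Require Import all_classical wochoice.

Set Implicit Arguments.
Unset Strict Implicit.
Unset Printing Implicit Defensive.

Local Open Scope classical_set_scope.
Local Open Scope card_scope.

(* A cardinal is represented by any type of that cardinality. *)

Definition card_lt (X Y : Type) : Prop :=
  [set: X] #<= [set: Y] /\ ~ ([set: Y] #<= [set: X]).

Definition is_succ_card (K X : Type) : Prop :=
  card_lt X K /\ forall Y : Type, card_lt X Y -> [set: K] #<= [set: Y].

Definition is_limit_card (K : Type) : Prop :=
  forall X : Type, card_lt X K -> exists2 Y : Type, card_lt X Y & card_lt Y K.

(* [I] is well-ordered in the order type of a cardinal, viewed as an initial
   ordinal. *)
Definition is_initial_ordinal (d : Order.disp_t) (I : orderType d) : Prop :=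
  well_order (<=%O : rel I) /\
  forall i : I, ~ ([set: I] #<= [set j : I | (j < i)%O]).

Record language : Type := Language {
  fsym : Type;
  farity : fsym -> nat;
  rsym : Type;
  rarity : rsym -> nat
}.

Inductive term (L : language) (V : Type) : Type :=
| Var of V
| App (f : fsym L) of ('I_(farity f) -> term L V).

(* Formulas with free variables in [V]; in [All f] the variable [None] of [f] is
   the one being bound. *)
Inductive formula (L : language) (V : Type) : Type :=
| Bot
| Eq of term L V & term L V
| Rel (r : rsym L) of ('I_(rarity r) -> term L V)
| Imp of formula L V & formula L V
| All of formula L (option V).

Arguments Bot {L V}.

Definition Neg (L : language) (V : Type) (f : formula L V) : formula L V :=
  Imp f Bot.

Definition sentence (L : language) : Type := formula L void.

Record structure (L : language) : Type := Structure {
  carrier :> Type;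
  carrier_inhabited : inhabited carrier;
  finterp : forall f : fsym L, ('I_(farity f) -> carrier) -> carrier;
  rinterp : forall r : rsym L, ('I_(rarity r) -> carrier) -> Prop
}.

Arguments finterp {L} s f _.
Arguments rinterp {L} s r _.

Section Semantics.
Variables (L : language) (M : structure L).

Fixpoint eval (V : Type) (e : V -> M) (t : term L V) : M :=
  match t with
  | Var v => e v
  | App f ts => finterp M f (fun i => eval e (ts i))
  end.

Fixpoint sat (V : Type) (e : V -> M) (f : formula L V) {struct f} : Prop :=
  match f with
  | Bot => False
  | Eq t u => eval e t = eval e u
  | Rel r ts => rinterp M r (fun i => eval e (ts i))
  | Imp g h => sat e g -> sat e h
  | All g => forall x : M, sat (fun v => oapp e x v) g
  end.

Definition models (T : set (sentence L)) : Prop :=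
  forall f, T f -> sat (of_void M) f.

(* Formulas over [A] in variables [V] are formulas in the variables [V + A],
   each element of [A] being a parameter that stands for itself. *)
Definition env (V : Type) (A : set M) (e : V -> M) (v : V + A) : M :=
  match v with
  | inl x => e x
  | inr a => val a
  end.

Definition same_type (V : Type) (A : set M) (e e' : V -> M) : Prop :=
  forall f : formula L (V + A), sat (env e) f <-> sat (env e') f.

Definition realizes (V : Type) (A : set M) (p : set (formula L (V + A)))
    (e : V -> M) : Prop :=
  forall f, p f -> sat (env e) f.

Definition is_partial_type (V : Type) (A : set M)
    (p : set (formula L (V + A))) : Prop :=
  forall q, q `<=` p -> finite_set q -> exists e : V -> M, realizes q e.

Definition is_automorphism (s : M -> M) : Prop :=
  [/\ bijective s,
      forall f (x : 'I_(farity f) -> M),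
        s (finterp M f x) = finterp M f (fun i => s (x i))
    & forall r (x : 'I_(rarity r) -> M),
        rinterp M r x <-> rinterp M r (fun i => s (x i))].

Definition is_saturated (K : Type) : Prop :=
  forall B : set M, card_lt B K ->
  forall q : set (formula L (unit + B)), is_partial_type q ->
  exists e : unit -> M, realizes q e.

Definition is_strongly_homogeneous (K : Type) : Prop :=
  forall V : Type, card_lt V K ->
  forall e e' : V -> M, same_type set0 e e' ->
  exists2 s : M -> M, is_automorphism s & forall v, s (e v) = e' v.

(* The sequence [a] of [J]-tuples, restricted to the indices in [D], is
   indiscernible over [B]. *)
Definition indiscernible (d : Order.disp_t) (I : orderType d) (J : Type)
    (D : set I) (B : set M) (a : I -> J -> M) : Prop :=
  forall (n : nat) (s t : 'I_n -> I),
    (forall k, D (s k)) -> (forall k, D (t k)) ->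
    {homo s : k l / (k < l)%N >-> (k < l)%O} ->
    {homo t : k l / (k < l)%N >-> (k < l)%O} ->
  same_type B (fun v : 'I_n * J => a (s v.1) v.2)
              (fun v : 'I_n * J => a (t v.1) v.2).

Definition mutually_indiscernible (d : Order.disp_t) (K : Type)
    (I : K -> orderType d) (J : K -> Type) (B : set M)
    (a : forall k, I k -> J k -> M) : Prop :=
  forall k,
    indiscernible setT
      (B `|` \bigcup_(l in [set l | l <> k]) \bigcup_i range (a l i)) (a k).

(* [rk_dp_lt S K p] is rk-dp(p) < |K|.  As usual in a monster model, sequences
   and their tuples are small, i.e. of cardinality < |S|. *)
Definition rk_dp_lt (S K V : Type) (A : set M) (p : set (formula L (V + A))) :
    Prop :=
  forall c : V -> M, realizes p c ->
  forall (d : Order.disp_t) (I : K -> orderType d) (J : K -> Type)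
         (a : forall k, I k -> J k -> M),
    (forall k, infinite_set [set: I k] /\ card_lt (I k) S) ->
    (forall k, card_lt (J k) S) ->
    mutually_indiscernible A a ->
  exists k, indiscernible setT (A `|` range c) (a k).

(* The bound |K| must be small: no more than |M| non-constant sequences can be
   mutually indiscernible, so with |K| unrestricted every type would qualify. *)
Definition dependent (S V : Type) (A : set M) (p : set (formula L (V + A))) :
    Prop :=
  exists2 K : Type, card_lt K S & rk_dp_lt S K p.

End Semantics.

Definition entails (L : language) (T : set (sentence L)) (f : sentence L) :
    Prop :=
  forall M : structure L, models M T -> sat (of_void M) f.

Definition is_complete (L : language) (T : set (sentence L)) : Prop :=
  (exists M : structure L, models M T) /\
  forall f, entails T f \/ entails T (Neg f).

(* |T| is the number of formulas, |L| + aleph_0. *)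
Definition card_theory (L : language) : Type := formula L nat.

(* [S] is the saturation cardinal of [C]; "small" means of cardinality < |S|. *)
Definition is_monster_model (L : language) (T : set (sentence L)) (S : Type)
    (C : structure L) : Prop :=
  [/\ models C T, is_limit_card S, card_lt (card_theory L) S,
      is_saturated C S & is_strongly_homogeneous C S].

(* Main.v *)
(** Suppose the dp-rank of [p] is not below a small cardinal [K] exceeding
    [|T| + |A| + |X|]. A realization [c] of [p] then destroys the
    indiscernibility of each of [K] mutually indiscernible sequences, and by
    pigeonhole infinitely many of them are destroyed by one [A]-definable
    predicate [P(y, c)], true at a tuple [y_l^1] and false at a tuple [y_l^0].
    Mutual indiscernibility lets one swap [y_l^0] and [y_l^1] independently
    for each [l], so by homogeneity every subset of the [y_l^1] is cut out by
    [P(y, c')] for some realization [c'] of [p]. Exchanging the roles of the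
    two sides of [P], an infinite sequence of realizations of [p] is shattered
    by instances of [P]. Ramsey's theorem and compactness turn it into an
    [A]-indiscernible sequence indexed by [W], along which some [P(d, -)]
    changes its truth value cofinally. Only finitely many coordinates of [d]
    matter; adding them to the parameters one by one, the hypothesis on [p]
    yields a tail indiscernible over [A] and these coordinates, a
    contradiction. *)

Require Import Defs.
From mathcomp Require Import all_boot all_order.
From mathcomp Require Import all_classical wochoice.

Set Implicit Arguments.
Unset Strict Implicit.
Unset Printing Implicit Defensive.

Import Order.TTheory Order.NatMonotonyTheory.

Local Open Scope classical_set_scope.
Local Open Scope card_scope.

Local Notation increasing f := {homo f : i j / (i < j)%O}.

(** * Finite sets and well-founded recursion *)

Lemma finite_set_ind (T : Type) (P : set T -> Prop) :
  P set0 -> (forall x A, finite_set A -> P A -> P (x |` A)) ->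
  forall A, finite_set A -> P A.
Proof.
move=> P0 P1 A; elim/Pchoice: T => T in P P0 P1 A *.
move=> /finite_seqP[s ->]; elim: s => [|x s Ps]; first by rewrite set_nil.
rewrite (_ : [set` _] = x |` [set` s]); first exact: P1.
by apply/seteqP; split=> y /=; rewrite inE => /predU1P.
Qed.

Lemma finite_sub_image (T U : Type) (f : T -> U) (D : set T) (F : set U) :
  finite_set F -> F `<=` f @` D ->
  exists D0, [/\ finite_set D0, D0 `<=` D & F = f @` D0].
Proof.
move: F; apply: finite_set_ind => [_|y F _ IH yFD].
  by exists set0; split; rewrite ?image_set0 //; exact: sub0set.
have [|D0 [D0_fin D0D ->]] := IH; first by move=> z Fz; apply: yFD; right.
have [x Dx <-] := yFD y (or_introl erefl).
exists (x |` D0); split; first by rewrite finite_setU.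
  by move=> z [->|/D0D].
by rewrite image_setU image_set1.
Qed.

Lemma finite_sub_bigcup_chain (T : Type) (F : set (set T)) (A : set T) :
  finite_set A -> total_on F subset -> A `<=` \bigcup_(G in F) G ->
  A = set0 \/ exists2 G, F G & A `<=` G.
Proof.
move=> + F_chain; move: A; apply: finite_set_ind => [|x A _ IH xAF].
  by left.
right; have [G FG Gx] := xAF _ (or_introl erefl).
have [|->|[H FH AH]] := IH; first exact: subset_trans xAF.
  by exists G => // y [->|[]].
have [GH|HG] := F_chain _ _ FG FH.
  by exists H => // y [->|/AH //]; exact: GH.
by exists G => // y [->//|/AH/HG].
Qed.

Lemma tukey_lemma (T : Type) (P : set (set T)) : P set0 ->
  (forall A, P A <-> forall B, finite_set B -> B `<=` A -> P B) ->
  exists A, P A /\ forall B, A `<` B -> ~ P B.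
Proof.
move=> P0 P_fin; apply: Zorn_bigcup => F FP F_chain; apply/P_fin => B B_fin BF.
have [->//|[G FG BG]] := finite_sub_bigcup_chain B_fin F_chain BF.
exact: (P_fin G).1 (FP _ FG) B B_fin BG.
Qed.

Lemma wf_dependent_choice (X Y : Type) (lt : X -> X -> Prop)
    (C : X -> (X -> Y) -> Y -> Prop) (y0 : Y) : well_founded lt ->
  (forall x g g' z, C x g z -> (forall w, lt w x -> g w = g' w) -> C x g' z) ->
  (forall x g, exists z, C x g z) ->
  exists f, forall x, C x f (f x).
Proof.
move=> lt_wf C_local C_ex.
have /choice[next nextP] (xg : X * (X -> Y)) : exists z, C xg.1 xg.2 z.
  exact: C_ex.
pose extend x (g : forall w, lt w x -> Y) w :=
  if pselect (lt w x) is left wx then g w wx else y0.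
pose F x g := next (x, extend x g).
pose f := Fix lt_wf (fun=> Y) F.
have fE x : f x = F x (fun w _ => f w).
  rewrite /f Fix_eq // => w g h gh; congr (F w).
  by do 2!apply: functional_extensionality_dep => ?.
exists f => x; rewrite fE.
apply: (C_local x _ _ _ (nextP (x, extend x (fun w _ => f w)))) => w wx.
by rewrite /= /extend; case: pselect.
Qed.

(** * Cardinal arithmetic *)

Lemma card_le_inj (T U : Type) (A : set T) (B : set U) (f : T -> U) :
  set_fun A B f -> set_inj A f -> A #<= B.
Proof.
move=> fAB f_inj; have [g] : $|{injfun A >-> B}| by apply/injfunPex; exists f.
exact: inj_card_le.
Qed.

Lemma card_le_fun (T U : Type) (A : set T) (B : set U) : A #<= B ->
  A !=set0 -> exists2 f : T -> U, set_fun A B f & set_inj A f.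
Proof.
elim/Ppointed: U => U in B *; last by rewrite -injfunPex => /pcard_leP.
by rewrite emptyE => /eqP -> [].
Qed.

Lemma card_leTP (X Y : Type) :
  [set: X] #<= [set: Y] <-> exists f : X -> Y, injective f.
Proof.
split=> [XY|[f f_inj]]; last first.
  by apply: (card_le_inj (f := f)) => // ? ? _ _ /f_inj.
have [[x _]|nX] := pselect ([set: X] !=set0); last first.
  have noX (x : X) : False by apply: nX; exists x.
  by exists (fun x => False_rect Y (noX x)) => x; case: (noX x).
have [|f _ f_inj] := card_le_fun XY; first by exists x.
by exists f => ? ? /f_inj; apply; rewrite inE.
Qed.

Lemma card_le_setX (T T' U U' : Type) (A : set T) (A' : set T') (B : set U)
    (B' : set U') : A #<= B -> A' #<= B' -> A `*` A' #<= B `*` B'.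
Proof.
move=> AB AB'.
have [->|/set0P[[x x'] [Ax Ax']]] := eqVneq (A `*` A') set0.
  exact: card_ge0.
have [|f fAB f_inj] := card_le_fun AB; first by exists x.
have [|f' fAB' f'_inj] := card_le_fun AB'; first by exists x'.
apply: (card_le_inj (f := fun z => (f z.1, f' z.2))).
  by move=> z [/fAB ? /fAB' ?].
move=> [y y'] [z z']; rewrite !inE => -[Ay Ay'] [Az Az'] /= [fyz f'yz].
by congr pair; [apply: f_inj|apply: f'_inj]; rewrite ?inE.
Qed.

Definition initial_segment (T : Type) (lt : T -> T -> Prop) (x : T) : set T :=
  [set y | lt y x].

(* Greedily send each point to a value not taken before it. *)
Lemma card_le_wf (T U : Type) (A : set T) (B : set U) (lt : T -> T -> Prop) :
  well_founded lt -> (forall x y, x <> y -> lt x y \/ lt y x) ->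
  (forall x, A x -> ~~ (B #<= A `&` initial_segment lt x)) -> A #<= B.
Proof.
move=> lt_wf lt_total small.
have [->|/set0P[x0 Ax0]] := eqVneq A set0; first exact: card_ge0.
have [u0 Bu0] : B !=set0.
  by apply/set0P; apply: contraNN (small _ Ax0) => /eqP ->; exact: card_ge0.
pose fresh x (g : T -> U) z :=
  A x -> B z /\ forall w, A w -> lt w x -> g w <> z.
have [x g g' z g_fresh gg' Ax|x g|f fP] :=
    wf_dependent_choice (C := fresh) u0 lt_wf.
- by have [Bz gz] := g_fresh Ax; split=> // w Aw wx; rewrite -gg' //; exact: gz.
- apply: contrapT => none; have [Ax|nAx] := pselect (A x); last first.
    by apply: none; exists u0.
  apply: (negP (small _ Ax)); apply: card_le_trans (card_image_le g _).
  apply: subset_card_le => z Bz; apply: contrapT => gz; apply: none.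
  by exists z => _; split=> // w Aw wx gw; apply: gz; exists w.
apply: (card_le_inj (f := f)) => [x /(fP x)[]//|x y]; rewrite !inE => Ax Ay fxy.
apply: contrapT => /lt_total[xy|yx].
  by have [_ /(_ x Ax xy)] := fP y Ay.
by have [_ /(_ y Ay yx)] := fP x Ax; rewrite fxy.
Qed.

Lemma well_order_lt_wf (T : eqType) (R : rel T) : well_order R ->
  well_founded (fun x y => R x y && (x != y)).
Proof.
move=> R_wo x; apply: contrapT => nx.
have [|z [[/asboolP nz zmin] _]] :=
    R_wo (fun x => `[< ~ Acc (fun x y => R x y && (x != y)) x >]).
  by exists x; apply/asboolP.
apply: nz; split=> y /andP[yz neq]; apply: contrapT => ny.
have zy := zmin y (asboolT ny).
have := @wo_chain_antisymmetric _ R predT (fun A _ => R_wo A).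
move=> /(_ y z erefl erefl); rewrite yz zy => /(_ isT)/eqP.
by rewrite (negPf neq).
Qed.

Lemma exists_strict_well_order (T : Type) : exists2 lt : T -> T -> Prop,
  well_founded lt & forall x y, x <> y -> lt x y \/ lt y x.
Proof.
elim/Pchoice: T => T; have [R R_wo] := well_ordering_principle T.
exists (fun x y => R x y && (x != y)); first exact: well_order_lt_wf.
move=> x y /eqP xy; rewrite (eq_sym y) xy !andbT.
by apply/orP/(@wo_chainW _ R predT) => // A _; exact: R_wo.
Qed.

Lemma card_le_total (T U : Type) (A : set T) (B : set U) :
  (A #<= B) || (B #<= A).
Proof.
have [lt lt_wf lt_total] := exists_strict_well_order T.
apply/orP; have [[x Ax Bx]|none] :=
    pselect (exists2 x, A x & B #<= A `&` initial_segment lt x).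
  by right; apply: card_le_trans Bx _; apply: subset_card_le => y [].
left; apply: (card_le_wf lt_wf lt_total) => x Ax; apply/negP => Bx.
by apply: none; exists x.
Qed.

Lemma wf_lex_measure (T U : Type) (lt : T -> T -> Prop) (lt' : U -> U -> Prop)
    (m : T -> U) : well_founded lt -> well_founded lt' ->
  well_founded (fun x y => lt' (m x) (m y) \/ m x = m y /\ lt x y).
Proof.
move=> lt_wf lt'_wf x; move: {2}(m x) (erefl (m x)) => u.
elim/(well_founded_ind lt'_wf): u x => u IHu x.
elim/(well_founded_ind lt_wf): x => x IHx mx.
split=> y [yx|[myx yx]]; last by apply: IHx => //; rewrite myx.
by apply: (IHu (m y)) => //; rewrite -mx.
Qed.

Lemma infinite_setU1_card_le (T : Type) (A : set T) (x : T) :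
  infinite_set A -> x |` A #<= A.
Proof.
move=> /infiniteP natA.
have [|h hA h_inj] := card_le_fun natA; first by exists 0%N.
pose D := range (oapp h x).
have D_range : D #<= range h.
  apply: card_le_trans (card_image_le _ _) _.
  apply: card_le_trans (countableP [set: option nat]) _.
  by have := inj_card_eq h_inj; rewrite card_eq_le => /andP[].
have Dx : D x by exists None.
have [|u uD u_inj] := card_le_fun D_range; first by exists x.
have range_D y : range h y -> D y by move=> [n _ <-]; exists (Some n).
apply: (card_le_inj (f := fun y => if pselect (D y) is left _ then u y else y)).
  move=> y xAy /=; case: pselect => [/uD[n _ <-]|nDy]; first exact: hA.
  by case: xAy => // yx; case: nDy; rewrite yx.
have outside y z : D y -> ~ D z -> u y <> z.
  by move=> /uD/range_D + nDz uyz; rewrite uyz.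
move=> y z _ _ /=; case: pselect => Dy; case: pselect => Dz // e.
- by apply: u_inj; rewrite ?inE.
- by case: (outside _ _ Dy Dz).
- by case: (outside _ _ Dz Dy).
Qed.

Lemma wf_total_trans (T : Type) (lt : T -> T -> Prop) : well_founded lt ->
  (forall x y, x <> y -> lt x y \/ lt y x) ->
  forall x y z, lt x y -> lt y z -> lt x z.
Proof.
move=> lt_wf lt_total x y z xy yz.
have no_2cycle u : forall v, lt u v -> ~ lt v u.
  by elim/(well_founded_ind lt_wf): u => u IH v uv vu; exact: (IH v vu u).
have no_3cycle u : forall v w, lt u v -> lt v w -> ~ lt w u.
  by elim/(well_founded_ind lt_wf): u => u IH v w uv vw wu;
    exact: (IH w wu u v).
have [xz|/lt_total[//|zx]] := pselect (x = z).
  by case: (no_2cycle x y) => //; rewrite xz.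
by case: (no_3cycle x y z).
Qed.

Section CardinalSquare.
Variables (T : Type) (lt : T -> T -> Prop).
Hypotheses (lt_wf : well_founded lt)
  (lt_total : forall x y, x <> y -> lt x y \/ lt y x).

Local Notation seg := (initial_segment lt).

Definition larger_component (z : T * T) : T :=
  if pselect (lt z.1 z.2) then z.2 else z.1.

Lemma larger_component_box (z : T * T) (m := larger_component z) :
  ((m |` seg m) `*` (m |` seg m)) z.
Proof.
rewrite /m /larger_component; case: z @m => x y /=.
case: pselect => /= [xy|nxy].
  by split; [right|left].
split; first by left.
by have [->|/lt_total[]//] := pselect (y = x); [left|right].
Qed.

(* Order pairs by their larger component first: then the pairs below a given
   one fit into the square of a segment. *)
Lemma card_setX_self_small_segments (A : set T) : infinite_set A ->
  (forall m, A m -> ~~ (A #<= seg m)) ->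
  (forall m, A m -> infinite_set (seg m) -> seg m `*` seg m #<= seg m) ->
  A `*` A #<= A.
Proof.
move=> A_inf A_seg seg_sq.
have [lt2 lt2_wf lt2_total] := exists_strict_well_order (T * T).
pose larger := larger_component.
pose lt_max v w := lt (larger v) (larger w) \/ larger v = larger w /\ lt2 v w.
have lt_max_wf : well_founded lt_max by exact: wf_lex_measure.
apply: (card_le_wf lt_max_wf) => [z w zw|z [Az1 Az2]].
  have [e|/lt_total[]] := pselect (larger z = larger w); try by left; left.
    by have [] := lt2_total _ _ zw; [left|right]; right.
  by right; left.
set m := larger z; have Am : A m.
  by rewrite /m /larger /larger_component; case: ifP.
have below_box : (A `*` A) `&` initial_segment lt_max z `<=`
    (m |` seg m) `*` (m |` seg m).
  move=> w [_ wz]; have [] := larger_component_box w.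
  have larger_seg u : (larger w |` seg (larger w)) u -> (m |` seg m) u.
    case: wz => [wm|[-> _] //] [->|uw]; right => //.
    exact: (wf_total_trans lt_wf lt_total) uw wm.
  by move=> /larger_seg ? /larger_seg ?.
apply/negP => /card_le_trans/(_ (subset_card_le below_box)) A_box.
have [seg_fin|seg_inf] := pselect (finite_set (seg m)).
  by apply/A_inf/(card_le_finite A_box)/finite_setX; rewrite finite_setU.
apply: (negP (A_seg m Am)); apply: card_le_trans A_box _.
apply: card_le_trans (seg_sq m Am seg_inf).
by apply: card_le_setX; exact: infinite_setU1_card_le.
Qed.

Lemma card_setX_self_down_closed (A : set T) : infinite_set A ->
  (forall x y, A x -> lt y x -> A y) ->
  (forall m, A m -> infinite_set (seg m) -> seg m `*` seg m #<= seg m) ->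
  A `*` A #<= A.
Proof.
move=> A_inf A_down seg_sq.
have [[m Am A_seg]|none] := pselect (exists2 m, A m & A #<= seg m).
  have seg_inf : infinite_set (seg m) by move=> /(card_le_finite A_seg).
  apply: card_le_trans (card_le_setX A_seg A_seg) _.
  apply: card_le_trans (seg_sq m Am seg_inf) _.
  by apply: subset_card_le => y; exact: A_down.
apply: card_setX_self_small_segments => // m Am.
by apply/negP => A_seg; apply: none; exists m.
Qed.

End CardinalSquare.

Lemma card_setX_self (T : Type) (A : set T) : infinite_set A -> A `*` A #<= A.
Proof.
move=> A_inf; have [lt lt_wf lt_total] := exists_strict_well_order A.
have lt_trans := wf_total_trans lt_wf lt_total.
have seg_sq (x : A) : infinite_set (initial_segment lt x) ->
    initial_segment lt x `*` initial_segment lt x #<= initial_segment lt x.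
  elim/(well_founded_ind lt_wf): x => x IH seg_inf.
  apply: (card_setX_self_down_closed lt_wf lt_total) => // y z yx zy.
  exact: lt_trans zy yx.
have [A_le le_A] : A #<= [set: A] /\ [set: A] #<= A.
  by apply/andP; rewrite -card_eq_le; exact: card_setT_sym.
apply: card_le_trans (card_le_setX A_le A_le) _; apply: card_le_trans le_A.
apply: (card_setX_self_down_closed lt_wf lt_total) => // [fin|m _].
  exact/A_inf/(card_le_finite A_le).
exact: seg_sq.
Qed.

Lemma card_setX_le (T U V : Type) (A : set T) (B : set U) (C : set V) :
  infinite_set C -> A #<= C -> B #<= C -> A `*` B #<= C.
Proof.
move=> C_inf AC BC; apply: card_le_trans (card_setX_self C_inf).
exact: card_le_setX.
Qed.

Lemma card_setU_le (T U : Type) (A B : set T) (C : set U) :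
  infinite_set C -> A #<= C -> B #<= C -> A `|` B #<= C.
Proof.
move=> C_inf AC BC.
elim/Ppointed: T => T in A B AC BC *; first by rewrite emptyE.
have [g gA] := pcard_surjP AC; have [h hB] := pcard_surjP BC.
have boolC : [set: bool] #<= C.
  by apply: card_le_trans ((infiniteP _).1 C_inf); exact: countableP.
apply: card_le_trans (card_setX_le C_inf boolC (card_lexx C)).
apply: card_le_trans (card_image_le (fun z => if z.1 then g z.2 else h z.2) _).
apply: subset_card_le => x [/gA|/hB] [c Cc <-]; first by exists (true, c).
by exists (false, c).
Qed.

Lemma card_sum_le (X Y Z : Type) : infinite_set [set: Z] ->
  [set: X] #<= [set: Z] -> [set: Y] #<= [set: Z] -> [set: X + Y] #<= [set: Z].
Proof.
move=> Z_inf XZ YZ.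
rewrite (_ : [set: X + Y] = range inl `|` range inr); last first.
  by apply/seteqP; split=> // -[x|y] _; [left; exists x|right; exists y].
apply: card_setU_le => //; exact: card_le_trans (card_image_le _ _) _.
Qed.

Lemma card_prod_le (X Y Z : Type) : infinite_set [set: Z] ->
  [set: X] #<= [set: Z] -> [set: Y] #<= [set: Z] -> [set: X * Y] #<= [set: Z].
Proof. by move=> Z_inf XZ YZ; rewrite -setXTT; exact: card_setX_le. Qed.

Lemma card_seq_le (X Z : Type) : infinite_set [set: Z] ->
  [set: X] #<= [set: Z] -> [set: seq X] #<= [set: Z].
Proof.
move=> Z_inf /card_leTP[f f_inj]; have natZ := (infiniteP _).1 Z_inf.
have ZZ := card_prod_le Z_inf (card_lexx _) (card_lexx _).
have [g g_inj] := (card_leTP _ _).1 ZZ.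
have [z0 _] := infinite_setN0 Z_inf.
pose code := foldr (fun x z => g (f x, z)) z0.
apply: card_le_trans (card_prod_le Z_inf natZ (card_lexx _)); apply/card_leTP.
exists (fun s => (size s, code s)); elim=> [|x s IH] [|y t] //= [st].
by move=> /g_inj[/f_inj -> codeE]; congr cons; apply: IH; rewrite st codeE.
Qed.

Lemma infinite_fiber (K Q : Type) (F : K -> Q) : infinite_set [set: Q] ->
  ~ ([set: K] #<= [set: Q]) -> exists q, infinite_set (F @^-1` [set q]).
Proof.
move=> Q_inf KQ; apply: contrapT => fibers_finite; apply: KQ.
have /choice[g g_inj] q : exists g : K -> nat, set_inj (F @^-1` [set q]) g.
  apply/countable_injP/finite_set_countable; apply: contrapT => fiber_inf.
  by apply: fibers_finite; exists q.
apply: card_le_trans (card_prod_le Q_inf (card_lexx _) ((infiniteP _).1 Q_inf)).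
apply/card_leTP; exists (fun k => (F k, g (F k) k)) => k l [Fkl].
by rewrite Fkl; apply: g_inj; rewrite inE.
Qed.

Lemma card_ltNge (X Y : Type) : card_lt X Y <-> ~ ([set: Y] #<= [set: X]).
Proof.
split=> [[]//|nYX]; split=> //.
by have /orP[] := card_le_total [set: X] [set: Y].
Qed.

Lemma card_le_lt_trans (X Y Z : Type) :
  [set: X] #<= [set: Y] -> card_lt Y Z -> card_lt X Z.
Proof.
by rewrite !card_ltNge => XY nZY ZX; apply: nZY; exact: card_le_trans ZX XY.
Qed.

Section SmallCardinals.
Variable S : Type.
Hypothesis nat_lt : card_lt nat S.

Lemma card_lt_bound (X Y : Type) : card_lt X S -> card_lt Y S ->
  exists Z, [/\ card_lt Z S, infinite_set [set: Z],
                [set: X] #<= [set: Z] & [set: Y] #<= [set: Z]].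
Proof.
move=> X_lt Y_lt.
have max U V : card_lt U S -> card_lt V S ->
    exists Z, [/\ card_lt Z S, [set: U] #<= [set: Z] & [set: V] #<= [set: Z]].
  move=> ? ?; have /orP[?|?] := card_le_total [set: U] [set: V].
    by exists V.
  by exists U.
have [U [U_lt XU YU]] := max _ _ X_lt Y_lt.
have [Z [Z_lt UZ natZ]] := max _ _ U_lt nat_lt.
exists Z; split=> //; [exact/infiniteP|exact: card_le_trans UZ..].
Qed.

Lemma card_lt_sum (X Y : Type) :
  card_lt X S -> card_lt Y S -> card_lt (X + Y)%type S.
Proof.
move=> X_lt Y_lt; have [Z [Z_lt Z_inf XZ YZ]] := card_lt_bound X_lt Y_lt.
exact: card_le_lt_trans (card_sum_le Z_inf XZ YZ) Z_lt.
Qed.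

Lemma card_lt_prod (X Y : Type) :
  card_lt X S -> card_lt Y S -> card_lt (X * Y)%type S.
Proof.
move=> X_lt Y_lt; have [Z [Z_lt Z_inf XZ YZ]] := card_lt_bound X_lt Y_lt.
exact: card_le_lt_trans (card_prod_le Z_inf XZ YZ) Z_lt.
Qed.

Lemma card_lt_seq (X : Type) : card_lt X S -> card_lt (seq X) S.
Proof.
move=> X_lt; have [Z [Z_lt Z_inf XZ _]] := card_lt_bound X_lt X_lt.
exact: card_le_lt_trans (card_seq_le Z_inf XZ) Z_lt.
Qed.

Lemma card_lt_range (X Y : Type) (f : X -> Y) :
  card_lt X S -> card_lt (range f) S.
Proof.
by apply: card_le_lt_trans; rewrite (card_le_eql (card_setT _)) card_image_le.
Qed.

Lemma card_lt_setU (T : Type) (A B : set T) :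
  card_lt A S -> card_lt B S -> card_lt (A `|` B) S.
Proof.
move=> A_lt B_lt; have [Z [Z_lt Z_inf AZ BZ]] := card_lt_bound A_lt B_lt.
apply: card_le_lt_trans Z_lt; rewrite (card_le_eql (card_setT _)).
by apply: card_setU_le; rewrite // -(card_le_eql (card_setT _)).
Qed.

End SmallCardinals.

(** * Initial ordinals *)

Section InitialOrdinal.
Variables (d : Order.disp_t) (W : orderType d).
Hypotheses (W_ord : is_initial_ordinal W) (W_inf : infinite_set [set: W]).

Lemma initial_ordinal_wf : well_founded (fun i j : W => (i < j)%O).
Proof.
have := well_order_lt_wf W_ord.1; congr (well_founded _).
by apply/funext => i; apply/funext => j; rewrite lt_neqAle andbC.
Qed.

Lemma initial_ordinal_not_card_le (i : W) (A : set W) :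
  (forall j, A j -> (j <= i)%O) -> ~ ([set: W] #<= A).
Proof.
move=> A_le WA.
have A_sub : A `<=` i |` [set j | (j < i)%O].
  by move=> j /A_le; rewrite le_eqVlt => /predU1P[->|]; [left|right].
have [fin|inf] := pselect (finite_set [set j | (j < i)%O]).
  apply: W_inf; apply: card_le_finite WA (sub_finite_set A_sub _).
  by rewrite finite_setU.
apply: (W_ord.2 i); apply: card_le_trans WA _.
apply: card_le_trans (subset_card_le A_sub) _.
exact: infinite_setU1_card_le.
Qed.

Lemma initial_ordinal_cofinal (A : set W) (i : W) : [set: W] #<= A ->
  exists2 j, (i < j)%O & A j.
Proof.
move=> WA; apply: contrapT => A_le.
apply: (@initial_ordinal_not_card_le i A) => // j Aj.
by rewrite leNgt; apply/negP => ij; apply: A_le; exists j.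
Qed.

Lemma initial_ordinal_bicofinal_set : exists E : set W, forall i,
  (exists2 j, (i < j)%O & E j) /\ (exists2 j, (i < j)%O & ~ E j).
Proof.
have WW := card_sum_le W_inf (card_lexx _) (card_lexx _).
have [g g_inj] := (card_leTP _ _).1 WW.
exists (range (g \o inl)) => i; split.
  apply: initial_ordinal_cofinal.
  apply: (card_le_inj (f := g \o inl)) => [x _|]; first by exists x.
  by move=> x y _ _ /g_inj[].
have [|j ij [x _ gx]] := @initial_ordinal_cofinal (range (g \o inr)) i.
  apply: (card_le_inj (f := g \o inr)) => [x _|]; first by exists x.
  by move=> x y _ _ /g_inj[].
by exists j => // -[y _]; rewrite -gx => /g_inj.
Qed.

Lemma initial_ordinal_tail_card (i j : W) :
  ~ ([set k | (i < k)%O] #<= [set k | (k < j)%O]).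
Proof.
move=> tail_le; pose b := Order.max i j; pose C := [set k | (k <= b)%O].
have below_C : [set k | (k <= i)%O] #<= C.
  by apply: subset_card_le => k /= ki; rewrite /C /= le_max ki.
have tail_C : [set k | (i < k)%O] #<= C.
  apply: card_le_trans tail_le _; apply: subset_card_le => k /= /ltW kj.
  by rewrite /C /= le_max kj orbT.
have W_split : [set: W] = [set k | (k <= i)%O] `|` [set k | (i < k)%O].
  by apply/seteqP; split=> // k _; have [ki|ik] := leP k i; [left|right].
have [C_fin|C_inf] := pselect (finite_set C).
  apply: W_inf; rewrite W_split finite_setU.
  by split; [exact: card_le_finite below_C _|exact: card_le_finite tail_C _].
apply: (@initial_ordinal_not_card_le b C) => //.
by rewrite W_split; exact: card_setU_le.
Qed.

(* [f] enumerates the tail beyond [i] in increasing order, sending each point to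
   the least value not taken before it. *)
Lemma initial_ordinal_tail_iso (i : W) : exists f : W -> W,
  increasing f /\ range f = [set k | (i < k)%O].
Proof.
pose rest j (g : W -> W) :=
  [set k | (i < k)%O /\ forall l, (l < j)%O -> g l <> k].
pose least j g m := rest j g m /\ forall k, rest j g k -> (m <= k)%O.
have [j g g' m [[im gm] m_min] gg'|j g|f fP] :=
    wf_dependent_choice (C := least) i initial_ordinal_wf.
- split=> [|k [ik g'k]].
    by split=> // l lj; rewrite -gg' //; exact: gm.
  by apply: m_min; split=> // l lj; rewrite gg' //; exact: g'k.
- have [m rest_m] : rest j g !=set0.
    apply: contrapT => rest0; apply: (@initial_ordinal_tail_card i j).
    apply: card_le_trans (card_image_le g _); apply: subset_card_le => k ik.
    apply: contrapT => gk; apply: rest0; exists k; split=> // l lj glk.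
    by apply: gk; exists l.
  have [|n [[/asboolP rest_n n_min] _]] := W_ord.1 (fun k => `[< rest j g k >]).
    by exists m; apply/asboolP.
  by exists n; split=> // k rest_k; apply: n_min; apply/asboolP.
have f_incr : increasing f.
  move=> j k jk; have [[if_k f_k] _] := fP k; have [_ f_min] := fP j.
  rewrite lt_neqAle; apply/andP; split; first by apply/eqP; exact: f_k.
  by apply: f_min; split=> // l lj; apply: f_k; exact: lt_trans jk.
have f_ge j : (j <= f j)%O.
  elim/(well_founded_ind initial_ordinal_wf): j => j IH.
  rewrite leNgt; apply/negP => fj; have := f_incr _ _ fj.
  by rewrite ltNge IH.
exists f; split=> //; apply/seteqP; split=> [_ [j _ <-]|k ik].
  by have [[]] := fP j.
apply: contrapT => nk; have [_ /(_ k) fk_min] := fP k.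
have fk_le : (f k <= k)%O.
  by apply: fk_min; split=> // l _ flk; apply: nk; exists l.
by apply: nk; exists k => //; apply/le_anti; rewrite f_ge fk_le.
Qed.

End InitialOrdinal.

(** * Ramsey's theorem *)

Lemma increasing_enumeration (Q : set nat) : infinite_set Q ->
  exists2 h : nat -> nat, increasing h & forall i, Q (h i).
Proof.
move=> Q_inf; have /choice[next nextP] m : exists k, (m <= k)%N /\ Q k.
  apply: contrapT => none.
  apply: Q_inf; apply: sub_finite_set (finite_II m) => k Qk.
  by rewrite /= ltnNge; apply/negP => mk; apply: none; exists k.
pose h := fix h i := if i is j.+1 then next (h j).+1 else next 0%N.
exists h; last by case=> [|i]; exact: (nextP _).2.
by apply: homo_ltn_lt => i; exact: (nextP _).1.
Qed.

Lemma increasing_monochromatic (Q : set nat) :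
  exists2 h : nat -> nat, increasing h & forall i j, Q (h i) <-> Q (h j).
Proof.
have [Q_fin|Q_inf] := pselect (finite_set Q); last first.
  have [h h_incr Qh] := increasing_enumeration Q_inf.
  by exists h => // i j; split.
have [|h h_incr nQh] := @increasing_enumeration (~` Q).
  by move=> nQ_fin; apply: infinite_nat; rewrite -(setUv Q) finite_setU.
by exists h => // i j; split=> /nQh.
Qed.

Lemma diagonal_subsequence (Phi : nat -> (nat -> nat) -> Prop) :
  (forall x h (g : nat -> nat), increasing g -> Phi x h -> Phi x (h \o g)) ->
  (forall x (h : nat -> nat), increasing h ->
     exists2 g : nat -> nat, increasing g & Phi x (h \o g)) ->
  exists2 X : nat -> nat, increasing X &
    forall i, Phi (X i) (fun j => X (i.+1 + j)%N).
Proof.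
move=> Phi_sub Phi_ex.
have /choice[G GP] (xh : nat * (nat -> nat)) : exists g : nat -> nat,
    increasing xh.2 -> increasing g /\ Phi xh.1 (xh.2 \o g).
  have [xh_incr|nh] := pselect (increasing xh.2); last by exists id.
  by have [g ? ?] := Phi_ex xh.1 xh.2 xh_incr; exists g.
pose H := fix H i : nat -> nat := if i is j.+1
  then H j \o S \o G (H j 0%N, H j \o S) else id.
have H_incr i : increasing (H i).
  elim: i => //= i IH; have [|G_incr _] := GP (H i 0%N, H i \o S).
    by move=> j k jk; apply: IH.
  by move=> j k /G_incr jk; apply: IH.
have H_Phi i : Phi (H i 0%N) (H i.+1).
  by have [|_] := GP (H i 0%N, H i \o S); first by move=> j k jk; apply: H_incr.
have H_sub i k : exists f, H (i + k)%N = H i \o f.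
  elim: k => [|k [f Hf]]; first by exists id; rewrite addn0.
  exists (f \o S \o G (H (i + k)%N 0%N, H (i + k)%N \o S)).
  by rewrite addnS /= {1}Hf.
pose X i := H i 0%N.
have X_incr : increasing X.
  by apply: homo_ltn_lt => i; rewrite /X /=; apply: H_incr.
exists X => // i; have /choice[f fP] j : exists m, X (i.+1 + j)%N = H i.+1 m.
  by have [f Hf] := H_sub i.+1 j; exists (f 0%N); rewrite /X Hf.
rewrite (_ : (fun j => _) = H i.+1 \o f); last by apply: funext.
apply: Phi_sub (H_Phi i) => j k jk; rewrite ltNge; apply/negP => fkj.
have : (X (i.+1 + j) < X (i.+1 + k))%O.
  by apply: X_incr; rewrite ltEnat /= ltn_add2l.
by rewrite !fP ltNge (ltW_homo (H_incr i.+1)).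
Qed.

Definition ord_cons (T : Type) (n : nat) (x : T) (t : 'I_n -> T)
    (i : 'I_n.+1) : T := oapp t x (unlift ord0 i).

Lemma ord_cons_eta (T : Type) (n : nat) (s : 'I_n.+1 -> T) :
  ord_cons (s ord0) (s \o lift ord0) = s.
Proof. by apply: funext => i; rewrite /ord_cons; case: unliftP => [j|] ->. Qed.

Definition homogeneous (n : nat) (P : set ('I_n -> nat))
    (h : nat -> nat) : Prop :=
  forall s t : 'I_n -> nat, increasing s -> increasing t ->
    P (h \o s) <-> P (h \o t).

Lemma homogeneous_comp (n : nat) (P : set ('I_n -> nat)) (h g : nat -> nat) :
  increasing g -> homogeneous P h -> homogeneous P (h \o g).
Proof.
by move=> g_incr hP s t s_incr t_incr; apply: (hP (g \o s) (g \o t)) => i j ij;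
  apply: g_incr; [apply: s_incr|apply: t_incr].
Qed.

Lemma ramsey (n : nat) (P : set ('I_n -> nat)) :
  exists2 h : nat -> nat, increasing h & homogeneous P h.
Proof.
elim: n P => [|n IH] P.
  by exists id => // s t _ _; rewrite (_ : s = t) //; apply: funext => -[].
have [x h g|x h h_incr|X X_incr X_hom] := @diagonal_subsequence
    (fun x => homogeneous (fun t => P (ord_cons x t))).
- exact: homogeneous_comp.
- have [g g_incr g_hom] := IH (fun t => P (ord_cons x (h \o t))).
  by exists g.
pose color i := P (ord_cons (X i) (fun k : 'I_n => X (i.+1 + k)%N)).
have color_head (s : 'I_n.+1 -> nat) :
    increasing s -> P (X \o s) <-> color (s ord0).
  move=> s_incr.
  have s_gt k : (s ord0 < s (lift ord0 k))%N := s_incr ord0 (lift ord0 k) isT.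
  pose t (k : 'I_n) := (s (lift ord0 k) - (s ord0).+1)%N.
  have -> : X \o s =
      ord_cons (X (s ord0)) ((fun j => X ((s ord0).+1 + j)%N) \o t).
    rewrite -[LHS]ord_cons_eta; congr ord_cons; apply: funext => k /=.
    by rewrite /t subnKC.
  apply: X_hom => [k l kl|//].
  rewrite ltEnat /= ltn_sub2rE //.
  exact: (s_incr (lift ord0 k) (lift ord0 l)).
have [h h_incr h_color] := increasing_monochromatic color.
exists (X \o h) => [i j ij|s t s_incr t_incr].
  by apply: X_incr; exact: h_incr.
rewrite -[(X \o h) \o s]/(X \o (h \o s)) -[(X \o h) \o t]/(X \o (h \o t)).
rewrite !color_head; first exact: h_color.
  by move=> k l kl; apply: h_incr; exact: t_incr.
by move=> k l kl; apply: h_incr; exact: s_incr.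
Qed.

Lemma ramsey_finite_family (D : set {n & set ('I_n -> nat)}) : finite_set D ->
  exists2 h : nat -> nat, increasing h &
    forall P, D P -> homogeneous (projT2 P) h.
Proof.
move: D; apply: finite_set_ind => [|P D _ [h h_incr h_hom]]; first by exists id.
have [g g_incr g_hom] := ramsey (fun s => projT2 P (h \o s)).
exists (h \o g) => [i j ij|Q [->//|DQ]]; first by apply: h_incr; exact: g_incr.
by apply: homogeneous_comp g_incr (h_hom Q DQ).
Qed.

(** * Definable predicates *)

Section Renaming.
Variable L : language.

Fixpoint term_rename (V U : Type) (h : V -> U) (t : term L V) : term L U :=
  match t with
  | Var v => Var L (h v)
  | App f ts => App (f := f) (fun i => term_rename h (ts i))
  end.

Fixpoint formula_rename (V : Type) (f : formula L V) {struct f} :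
    forall U : Type, (V -> U) -> formula L U :=
  match f with
  | Bot => fun U h => Bot
  | Eq t u => fun U h => Eq (term_rename h t) (term_rename h u)
  | Rel r ts => fun U h => Rel (r := r) (fun i => term_rename h (ts i))
  | Imp g k => fun U h => Imp (formula_rename g h) (formula_rename k h)
  | All g => fun U h => All (formula_rename g (omap h))
  end.

Lemma card_nat_le_formula : [set: nat] #<= [set: formula L nat].
Proof.
by apply/card_leTP; exists (fun n => Eq (Var L n) (Var L n)) => n m [].
Qed.

End Renaming.

Section Satisfaction.
Variables (L : language) (M : structure L).

Lemma eval_rename (V U : Type) (h : V -> U) (t : term L V) (e : U -> M) :
  eval e (term_rename h t) = eval (e \o h) t.
Proof. by elim: t => //= f ts IH; congr finterp; apply: funext. Qed.

Lemma sat_rename (V U : Type) (f : formula L V) (h : V -> U) (e : U -> M) :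
  sat e (formula_rename f h) <-> sat (e \o h) f.
Proof.
elim: f U h e => //= [{}V t u|{}V r ts|{}V g IHg g' IHg'|{}V g IH] U h e.
- by rewrite !eval_rename.
- by under eq_fun do rewrite eval_rename.
- by rewrite IHg IHg'.
- have ext x : oapp e x \o omap h = (fun v => oapp (e \o h) x v).
    by apply: funext; case.
  by split=> sat_g x; move: (sat_g x); rewrite IH ext.
Qed.

Lemma eval_finite_support (V : Type) (t : term L V) :
  exists D : set V, finite_set D /\
    forall e e' : V -> M, (forall v, D v -> e v = e' v) -> eval e t = eval e' t.
Proof.
elim: t => [v|f ts /choice[D /all_and2[D_fin DP]]].
  by exists [set v]; split=> [|e e']; [exact: finite_set1|exact].
exists (\bigcup_i D i); split; first exact: bigcup_finite.
move=> e e' ee' /=; congr finterp; apply: funext => i.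
by apply: DP => v Dv; apply: ee'; exists i.
Qed.

Lemma sat_finite_support (V : Type) (f : formula L V) :
  exists D : set V, finite_set D /\
    forall e e' : V -> M, (forall v, D v -> e v = e' v) -> sat e f <-> sat e' f.
Proof.
elim: f => [{}V|{}V t u|{}V r ts|{}V g [D [D_fin DP]] g' [D' [D'_fin D'P]]|
            {}V g [D [D_fin DP]]].
- by exists set0.
- have [D [D_fin DP]] := eval_finite_support t.
  have [D' [D'_fin D'P]] := eval_finite_support u.
  exists (D `|` D'); split; first by rewrite finite_setU.
  move=> e e' ee' /=; rewrite (DP e e') ?(D'P e e') // => v Dv; apply: ee'.
    by right.
  by left.
- have /choice[D /all_and2[D_fin DP]] i := eval_finite_support (ts i).
  exists (\bigcup_i D i); split; first exact: bigcup_finite.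
  move=> e e' ee' /=; rewrite (_ : (fun i => _) = (fun i => eval e' (ts i))) //.
  by apply: funext => i; apply: DP => v Dv; apply: ee'; exists i.
- exists (D `|` D'); split; first by rewrite finite_setU.
  move=> e e' ee' /=; rewrite (DP e e') ?(D'P e e') // => v Dv; apply: ee'.
    by right.
  by left.
- exists (Some @^-1` D); split.
    by apply: finite_preimage => // ? ? _ _ [].
  move=> e e' ee' /=; split=> sat_g x; move: (sat_g x).
    by apply DP => -[v|] //= Dv; exact/esym/ee'.
  by apply DP => -[v|] //= Dv; exact: ee'.
Qed.

Lemma automorphism_eval (s : M -> M) (V : Type) (e : V -> M) (t : term L V) :
  is_automorphism s -> eval (s \o e) t = s (eval e t).
Proof.
move=> [_ s_fun _]; elim: t => //= f ts IH.
by rewrite s_fun; congr finterp; apply: funext.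
Qed.

Lemma automorphism_sat (s : M -> M) (V : Type) (f : formula L V) (e : V -> M) :
  is_automorphism s -> sat (s \o e) f <-> sat e f.
Proof.
move=> s_auto; have [[s' sK s'K] _ s_rel] := s_auto.
elim: f e => //= [{}V t u|{}V r ts|{}V g IHg k IHk|{}V g IH] e.
- by rewrite !automorphism_eval //; split=> [/(can_inj sK)|->].
- by under eq_fun do rewrite automorphism_eval //; rewrite -s_rel.
- by rewrite IHg IHk.
- have ext x : (fun v => oapp (s \o e) (s x) v) = s \o (fun v => oapp e x v).
    by apply: funext; case.
  split=> sat_g x; first by have := sat_g (s x); rewrite ext IH.
  by rewrite -[x]s'K ext IH.
Qed.

End Satisfaction.

Section Definability.
Variables (L : language) (M : structure L).

Definition definable (V : Type) (A : set M) (P : (V -> M) -> Prop) : Prop :=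
  exists f : formula L (V + A), forall e, sat (env e) f <-> P e.

Definition update (V : Type) (e : V -> M) (v : V) (x : M) (w : V) : M :=
  if pselect (w = v) is left _ then x else e w.

Definition join_env (U V : Type) (e : U -> M) (e' : V -> M) (w : U + V) : M :=
  match w with inl u => e u | inr v => e' v end.

Lemma definable_sat (V : Type) (A : set M) (f : formula L (V + A)) :
  definable A (fun e => sat (env e) f).
Proof. by exists f. Qed.

Lemma eq_definable (V : Type) (A : set M) (P P' : (V -> M) -> Prop) :
  (forall e, P e <-> P' e) -> definable A P -> definable A P'.
Proof. by move=> PP' [f fP]; exists f => e; rewrite fP. Qed.

Section Connectives.
Variables (V : Type) (A : set M).
Implicit Types P Q : (V -> M) -> Prop.

Lemma definable_cst (C : Prop) : definable A (fun _ : V -> M => C).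
Proof.
have [c|nc] := pselect C; first by exists (Neg Bot) => e; split=> // _ [].
by exists Bot.
Qed.

Lemma definable_imp P Q :
  definable A P -> definable A Q -> definable A (fun e => P e -> Q e).
Proof. by move=> [f fP] [g gQ]; exists (Imp f g) => e /=; rewrite fP gQ. Qed.

Lemma definable_not P : definable A P -> definable A (fun e => ~ P e).
Proof. by move=> P_def; apply: definable_imp => //; exact: definable_cst. Qed.

Lemma definable_and P Q :
  definable A P -> definable A Q -> definable A (fun e => P e /\ Q e).
Proof.
move=> P_def Q_def.
have PQ_def := definable_not (definable_imp P_def (definable_not Q_def)).
apply: eq_definable PQ_def => e.
by split=> [/not_implyP[? /contrapT]|[? ?]]; [split|apply].
Qed.

Lemma definable_iff P Q :
  definable A P -> definable A Q -> definable A (fun e => P e <-> Q e).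
Proof. by move=> ? ?; apply: definable_and; exact: definable_imp. Qed.

Lemma definable_finite_forall (F : set ((V -> M) -> Prop)) : finite_set F ->
  (forall P, F P -> definable A P) ->
  definable A (fun e => forall P, F P -> P e).
Proof.
move: F; apply: finite_set_ind => [_|P F _ IH F_def].
  by apply: eq_definable (definable_cst True).
have F'_def : definable A (fun e => forall Q, F Q -> Q e).
  by apply: IH => Q FQ; apply: F_def; right.
apply: eq_definable (definable_and (F_def P (or_introl erefl)) F'_def) => e.
split=> [[Pe Fe] Q [->//|FQ]|PFe]; first exact: Fe.
by split=> [|Q FQ]; apply: PFe; [left|right].
Qed.

Lemma definable_finite_support P : definable A P ->
  exists D : set V, finite_set D /\
    forall e e', (forall v, D v -> e v = e' v) -> P e <-> P e'.
Proof.
move=> [f fP]; have [D [D_fin DP]] := sat_finite_support M f.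
exists (inl @^-1` D); split; first by apply: finite_preimage => // ? ? _ _ [].
by move=> e e' ee'; rewrite -!fP; apply: DP => -[v|//] Dv; exact: ee'.
Qed.

End Connectives.

Lemma definable_subst (U V : Type) (A B : set M) (P : (V -> M) -> Prop)
    (k : V -> U + B) : A `<=` B -> definable A P ->
  definable B (fun e => P (env e \o k)).
Proof.
move=> AB [f fP]; pose h (z : V + A) : U + B := match z with
  | inl v => k v
  | inr a => inr (SigSub (mem_set (AB _ (set_mem (valP a)))))
  end.
exists (formula_rename f h) => e; rewrite sat_rename -fP.
by rewrite (_ : env e \o h = env (env e \o k)) //; apply: funext => -[].
Qed.

Lemma definable_comp (U V : Type) (A : set M) (P : (V -> M) -> Prop)
    (h : V -> U) : definable A P -> definable A (fun e => P (e \o h)).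
Proof. exact: (definable_subst (inl \o h) (@subset_refl _ A)). Qed.

Lemma definable_subset (V : Type) (A B : set M) (P : (V -> M) -> Prop) :
  A `<=` B -> definable A P -> definable B P.
Proof. exact: (definable_subst inl). Qed.

Lemma definable_join_envl (U V : Type) (A : set M) (P : (U + V -> M) -> Prop)
    (e : U -> M) :
  definable A P -> definable (A `|` range e) (fun e' => P (join_env e e')).
Proof.
have eB u : (A `|` range e) (e u) by right; exists u.
pose k (z : U + V) : V + (A `|` range e) :=
  match z with inl u => inr (SigSub (mem_set (eB u))) | inr v => inl v end.
move=> /(definable_subst k (@subsetUl _ A (range e))).
apply: eq_definable => e'; rewrite (_ : _ \o k = join_env e e') //.
by apply: funext => -[].
Qed.

Lemma definable_join_envr (U V : Type) (A : set M) (P : (U + V -> M) -> Prop)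
    (e' : V -> M) :
  definable A P -> definable (A `|` range e') (fun e => P (join_env e e')).
Proof.
pose swap (z : U + V) : V + U :=
  match z with inl u => inr u | inr v => inl v end.
move=> /(definable_comp swap)/(definable_join_envl e').
apply: eq_definable => e; rewrite (_ : _ \o swap = join_env e e') //.
by apply: funext => -[].
Qed.

Lemma definable_exists (V : Type) (A : set M) (P : (option V -> M) -> Prop) :
  definable A P -> definable A (fun e : V -> M => exists x, P (oapp e x)).
Proof.
move=> [f fP]; pose h (z : option V + A) : option (V + A) :=
  match z with inl w => omap inl w | inr a => Some (inr a) end.
have hE (e : V -> M) x : oapp (env e) x \o h = env (oapp e x).
  by apply: funext => -[[v|]|].
exists (Neg (All (Neg (formula_rename f h)))) => e.
have hP x : sat (oapp (env e) x) (formula_rename f h) <-> P (oapp e x).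
  by rewrite sat_rename hE fP.
split=> /= [nall|[x Px]]; last by move=> /(_ x); apply; exact/hP.
by apply: contrapT => none; apply: nall => x /hP Px; apply: none; exists x.
Qed.

Lemma definable_update (V : Type) (A : set M) (P : (V -> M) -> Prop) (v : V) :
  definable A P -> definable A (fun e => exists x, P (update e v x)).
Proof.
pose h w := if pselect (w = v) is left _ then None else Some w.
have hE (e : V -> M) x : oapp e x \o h = update e v x.
  by apply: funext => w; rewrite /= /h /update; case: pselect.
move=> /(definable_comp h)/definable_exists; apply: eq_definable => e.
by split=> -[x Px]; exists x; move: Px; rewrite hE.
Qed.

Lemma definable_projection (V : Type) (A : set M) (P : (V -> M) -> Prop)
    (D : set V) : definable A P ->
  definable A (fun e => exists2 e', (forall v, ~ D v -> e' v = e v) & P e').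
Proof.
move=> P_def; have [K [K_fin KP]] := definable_finite_support P_def.
have finite_case (F : set V) : finite_set F ->
    definable A (fun e => exists2 e', (forall v, ~ F v -> e' v = e v) & P e').
  move: F; apply: finite_set_ind => [|v F _ IH].
    apply: eq_definable P_def => e.
    split=> [Pe|[e' ee' Pe']]; first by exists e.
    by rewrite (_ : e = e') //; apply: funext => v; rewrite ee'.
  apply: eq_definable (definable_update v IH) => e.
  split=> [[x [e' ee' Pe']]|[e' ee' Pe']].
    exists e' => // w vFw; rewrite ee' => [|Fw]; last by apply: vFw; right.
    by rewrite /update; case: pselect => // wv; case: vFw; left.
  exists (e' v), e' => // w nFw; rewrite /update; case: pselect => [->//|wv].
  by apply: ee' => -[].
apply: eq_definable (finite_case (K `&` D) (finite_setIl _ K_fin)) => e.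
split=> [[e' ee' Pe']|[e' ee' Pe']].
  by exists e' => // v nDv; apply: ee' => -[].
pose e'' v := if pselect ((K `&` D) v) is left _ then e' v else e v.
exists e'' => [v|]; first by rewrite /e''; case: pselect.
apply/(KP _ e') => // v Kv; rewrite /e''; case: pselect => // nKDv.
by rewrite ee' // => Dv; apply: nKDv.
Qed.

Lemma definable_exists_join_env (U V : Type) (A : set M)
    (P : (U + V -> M) -> Prop) : definable A P ->
  definable A (fun e : V -> M => exists y, P (join_env y e)).
Proof.
pose h (z : U + V) := if z is inr v then Some v else None.
move=> /(definable_projection (range inl))/(definable_comp h)/definable_exists.
apply: eq_definable => e; split=> [[x [e' e'E Pe']]|[y Py]].
  exists (e' \o inl); rewrite (_ : join_env _ e = e') //.
  by apply: funext => -[//|v] /=; rewrite e'E // => -[].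
have [x] := carrier_inhabited M.
by exists x, (join_env y e) => // -[u|//] []; exists u.
Qed.

Lemma definable_range_params (V X : Type) (A : set M) (c : X -> M)
    (P : (V -> M) -> Prop) : definable (A `|` range c) P ->
  exists2 P' : (V + X -> M) -> Prop, definable A P' &
    forall e, P e <-> P' (join_env e c).
Proof.
move=> [f fP].
have /choice[k kP] (b : (A `|` range c : set M)) :
    exists z : X + A, env c z = val b.
  have [Ab|[x _ cx]] := set_mem (valP b); last by exists (inl x).
  by exists (inr (SigSub (mem_set Ab))).
pose h (z : V + (A `|` range c)) : (V + X) + A := match z with
  | inl v => inl (inl v)
  | inr b => match k b with inl x => inl (inr x) | inr a => inr a end
  end.
exists (fun e => sat (env e) (formula_rename f h)); first exact: definable_sat.
move=> e; rewrite -fP sat_rename (_ : env (join_env e c) \o h = env e) //.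
by apply: funext => -[//|b] /=; rewrite -(kP b); case: (k b).
Qed.

Lemma finite_set_nth (V : Type) (D : set V) (v0 : V) : finite_set D ->
  exists (s : seq V) (k : V -> nat), forall v, D v -> nth v0 s (k v) = v.
Proof.
elim/Pchoice: V => V in D v0 *.
move=> /finite_seqP[s ->]; exists s, (index^~ s) => v; exact: nth_index.
Qed.

(* Up to equivalence there are thus at most [|T| + |V| + |A|] predicates
   definable over [A]. *)
Lemma definable_code (V : Type) (A : set M) (P : (V -> M) -> Prop)
    (z0 : V + A) : definable A P ->
  exists c : formula L nat * seq (V + A),
    forall e, P e <-> sat (env e \o nth z0 c.2) c.1.
Proof.
move=> [f fP]; have [D [D_fin DP]] := sat_finite_support M f.
have [s [k kP]] := finite_set_nth z0 D_fin.
exists (formula_rename f k, s) => e; rewrite -fP sat_rename.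
by apply: DP => z Dz /=; rewrite kP.
Qed.

Lemma automorphism_definable (s : M -> M) (V : Type) (A : set M)
    (P : (V -> M) -> Prop) (e : V -> M) : is_automorphism s ->
  (forall a, A a -> s a = a) -> definable A P -> P (s \o e) <-> P e.
Proof.
move=> s_auto sA [f fP]; rewrite -!fP -(automorphism_sat f (env e) s_auto).
rewrite (_ : s \o env e = env (s \o e)) //.
by apply: funext => -[//|a] /=; rewrite sA //; exact: set_mem (valP a).
Qed.

Lemma same_typeP (V : Type) (A : set M) (e e' : V -> M) :
  same_type A e e' <-> forall P, definable A P -> P e <-> P e'.
Proof.
split=> [ee' P [f fP]|ee' f]; first by rewrite -!fP; exact: ee'.
exact: (ee' _ (definable_sat f)).
Qed.

End Definability.

(** * Compactness for definable predicates in small many variables *)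

Section Saturation.
Variables (L : language) (M : structure L) (S : Type).
Hypotheses (nat_lt : card_lt nat S) (M_sat : is_saturated M S).
Variables (V : Type) (A : set M).
Hypotheses (V_lt : card_lt V S) (A_lt : card_lt A S).

Lemma saturated_update (F : set ((V -> M) -> Prop)) (e : V -> M) (v : V) :
  (forall P, F P -> definable A P) ->
  (forall F0, F0 `<=` F -> finite_set F0 ->
    exists x, forall P, F0 P -> P (update e v x)) ->
  exists x, forall P, F P -> P (update e v x).
Proof.
move=> F_def F_finsat; pose B := A `|` range e.
have B_lt : card_lt B S by apply: card_lt_setU => //; exact: card_lt_range.
have eB w : B (e w) by right; exists w.
pose k (w : V) : unit + B :=
  if pselect (w = v) is left _ then inl tt else inr (SigSub (mem_set (eB w))).
have kE (x : unit -> M) : env x \o k = update e v (x tt).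
  by apply: funext => w; rewrite /= /k /update; case: pselect.
have /choice[f fP] P : exists f : formula L (unit + B), F P ->
    forall x, sat (env x) f <-> P (update e v (x tt)).
  have [/F_def P_def|nP] := pselect (F P); last by exists Bot => /nP.
  have [f fP] := definable_subst k (@subsetUl _ A (range e)) P_def.
  by exists f => _ x; rewrite fP kE.
have [q q_sub q_fin|x xF] := M_sat B_lt (q := f @` F).
  have [F0 [F0_fin F0F ->]] := finite_sub_image q_fin q_sub.
  have [x xF0] := F_finsat F0 F0F F0_fin; exists (fun=> x) => _ [P F0P <-].
  by apply/(fP P (F0F P F0P)); exact: xF0.
by exists (x tt) => P FP; apply/(fP P FP)/xF; exists P.
Qed.

Variable F : set ((V -> M) -> Prop).
Hypothesis F_def : forall P, F P -> definable A P.

Definition extends (G : set (V * M)) (e : V -> M) : Prop :=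
  forall v x, G (v, x) -> e v = x.

Definition finitely_satisfiable (G : set (V * M)) : Prop :=
  forall F0, F0 `<=` F -> finite_set F0 ->
  exists e, extends G e /\ forall P, F0 P -> P e.

Lemma finitely_satisfiable_finite_character (G : set (V * M)) :
  finitely_satisfiable G <->
  forall H, finite_set H -> H `<=` G -> finitely_satisfiable H.
Proof.
split=> [G_finsat H _ HG F0 F0F F0_fin|G_finsat F0 F0F F0_fin].
  have [e [eG eF0]] := G_finsat F0 F0F F0_fin; exists e.
  by split=> // v x /HG/eG.
have G_fun v x y : G (v, x) -> G (v, y) -> x = y.
  move=> Gx Gy; have [|e [eH _]] :=
    G_finsat _ (finite_set2 (v, x) (v, y)) _ _ (sub0set F) (finite_set0 _).
    by move=> _ [->|->].
  by rewrite -(eH v x) ?(eH v y); [|right|left].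
have [m0] := carrier_inhabited M.
have /choice[g gG] v : exists x, forall y, G (v, y) -> x = y.
  have [[x Gx]|nGv] := pselect (exists x, G (v, x)).
    by exists x => y; exact: G_fun.
  by exists m0 => y Gy; case: nGv; exists y.
have /choice[D DP] P : exists D, F0 P -> finite_set D /\
    forall e e', (forall v, D v -> e v = e' v) -> P e <-> P e'.
  have [/F0F/F_def P_def|nP] := pselect (F0 P); last by exists set0 => /nP.
  by have [D DP] := definable_finite_support P_def; exists D.
pose K := \bigcup_(P in F0) D P.
have K_fin : finite_set K by apply: bigcup_finite => // P /DP[].
have [||e [eH eF0]] := G_finsat (G `&` [set z | K z.1]) _ _ F0 F0F F0_fin.
- apply: sub_finite_set (finite_image (fun v => (v, g v)) K_fin).
  by move=> [v x] [/gG <- Kv]; exists v.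
- by move=> z [].
exists (fun v => if pselect (exists x, G (v, x)) is left _ then g v else e v).
split=> [v x Gx|P F0P].
  by case: pselect => [_|nGv]; [exact: gG|case: nGv; exists x].
have [_ D_supp] := DP P F0P; apply/(D_supp _ e); last exact: eF0.
move=> v Dv; case: pselect => // -[x Gx]; rewrite (gG _ _ Gx); apply/esym/eH.
by split=> //=; exists P.
Qed.

Lemma finitely_satisfiable_extend (G : set (V * M)) (v : V) :
  finitely_satisfiable G -> (forall x, ~ G (v, x)) ->
  exists x, finitely_satisfiable ((v, x) |` G).
Proof.
move=> G_finsat nGv.
have [e [eG _]] := G_finsat set0 (sub0set F) (finite_set0 _).
pose free := [set w | w <> v /\ forall x, ~ G (w, x)].
pose solvable (F0 : set ((V -> M) -> Prop)) (e0 : V -> M) :=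
  exists2 e', (forall w, ~ free w -> e' w = e0 w) & forall P, F0 P -> P e'.
pose F' := [set solvable F0 | F0 in [set F0 | F0 `<=` F /\ finite_set F0]].
have [_ [F0 [F0F F0_fin] <-]|F'0 F'0F' F'0_fin|x xP] :=
  @saturated_update F' e v.
- by apply/definable_projection/definable_finite_forall => // P /F0F/F_def.
- have [D [D_fin DF ->]] := finite_sub_image F'0_fin F'0F'.
  have [||e1 [e1G e1F]] := G_finsat (\bigcup_(F0 in D) F0).
  + by move=> P [F0 /DF[F0F _]]; exact: F0F.
  + by apply: bigcup_finite => // F0 /DF[].
  exists (e1 v) => _ [F0 DF0 <-].
  exists e1 => [w w_fixed|P F0P]; last by apply: e1F; exists F0.
  rewrite /update; case: pselect => [->//|wv].
  have [y Gy] : exists y, G (w, y).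
    apply: contrapT => nGw; apply: w_fixed; split=> // y Gy.
    by apply: nGw; exists y.
  by rewrite (e1G _ _ Gy) (eG _ _ Gy).
exists x => F0 F0F F0_fin.
have [|e' e'E e'F0] := xP (solvable F0); first by exists F0.
exists e'; split=> // w y [[-> ->]|Gy].
  by rewrite e'E => [|[]//]; rewrite /update; case: pselect.
rewrite e'E => [|[_ /(_ y)]//]; rewrite /update; case: pselect => [wv|_].
  by case: (nGv y); rewrite -wv.
exact: eG.
Qed.

Lemma realize_definable :
  (forall F0, F0 `<=` F -> finite_set F0 -> exists e, forall P, F0 P -> P e) ->
  exists e, forall P, F P -> P e.
Proof.
move=> F_finsat.
have [|G [G_finsat G_max]] := @tukey_lemma _ finitely_satisfiable _
  finitely_satisfiable_finite_character.
  move=> F0 F0F F0_fin; have [e eF0] := F_finsat F0 F0F F0_fin.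
  by exists e; split=> // ? ? [].
have /choice[e eG] v : exists x, G (v, x).
  apply: contrapT => nGv.
  have [|x x_finsat] := @finitely_satisfiable_extend G v G_finsat.
    by move=> x Gx; apply: nGv; exists x.
  apply: (G_max _ _ x_finsat); split; first by move=> z Gz; right.
  by move=> /(_ (v, x) (or_introl erefl)) Gx; apply: nGv; exists x.
exists e => P FP.
have [|e' [e'G e'P]] := G_finsat [set P] _ (finite_set1 P).
  by move=> _ ->.
rewrite (_ : e = e'); first exact: e'P.
by apply: funext => v; rewrite (e'G v (e v)).
Qed.

End Saturation.

(** * Indiscernible sequences *)

Lemma finite_set_increasing (d : Order.disp_t) (W : orderType d) (D : set W) :
  finite_set D -> exists n (s : 'I_n -> W), increasing s /\ D `<=` range s.
Proof.
move=> /finite_seqP[ws ->]; pose us := sort <=%O (undup ws).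
exists (size us), (tnth (in_tuple us)); split=> [i j ij|w /= w_ws].
  pose w0 := tnth (in_tuple us) i; rewrite (tnth_nth w0 _ i) (tnth_nth w0 _ j).
  by apply: (sorted_ltn_nth lt_trans);
    rewrite ?sort_lt_sorted ?undup_uniq ?inE ?ltn_ord.
have : w \in us by rewrite mem_sort mem_undup.
by move=> /(tnthP (in_tuple us))[i ->]; exists i.
Qed.

Lemma finite_set_increasing_index (d : Order.disp_t) (W : orderType d)
    (D : set W) : finite_set D ->
  exists r : W -> nat, {in D &, increasing r}.
Proof.
move=> /finite_set_increasing[n [s [s_incr Ds]]].
have /choice[r rP] w : exists k : nat, D w -> exists2 i : 'I_n, s i = w & k = i.
  have [/Ds[i _ <-]|nDw] := pselect (D w); last by exists 0%N => /nDw.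
  by exists i => _; exists i.
exists r => _ _ /set_mem/rP[i <- ->] /set_mem/rP[j <- ->].
by rewrite (leW_mono (le_mono s_incr)).
Qed.

Section Indiscernible.
Variables (L : language) (M : structure L).

Lemma same_type_subset (V : Type) (A B : set M) (e e' : V -> M) :
  A `<=` B -> same_type B e e' -> same_type A e e'.
Proof.
move=> AB /same_typeP ee'; apply/same_typeP => P P_def.
exact: ee' (definable_subset AB P_def).
Qed.

Lemma same_type_comp (V U : Type) (A : set M) (e e' : V -> M) (h : U -> V) :
  same_type A e e' -> same_type A (e \o h) (e' \o h).
Proof.
move=> /same_typeP ee'; apply/same_typeP => P P_def.
exact: ee' (definable_comp h P_def).
Qed.

Definition along (I X : Type) (n : nat) (a : I -> X -> M) (s : 'I_n -> I)
    (v : 'I_n * X) : M := a (s v.1) v.2.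

Definition realizes_EM (A : set M) (d d' : Order.disp_t) (I : orderType d)
    (W : orderType d') (X : Type) (c : I -> X -> M) (a : W -> X -> M) : Prop :=
  forall n (P : ('I_n * X -> M) -> Prop), definable A P ->
  (forall s : 'I_n -> I, increasing s -> P (along c s)) ->
  forall s : 'I_n -> W, increasing s -> P (along a s).

Lemma realizes_EM_realizes (A : set M) (d d' : Order.disp_t) (I : orderType d)
    (W : orderType d') (X : Type) (c : I -> X -> M) (a : W -> X -> M)
    (p : set (formula L (X + A))) : realizes_EM A c a ->
  (forall i, realizes p (c i)) -> forall i, realizes p (a i).
Proof.
move=> a_like_c c_p i f pf; pose h (x : X) : 'I_1 * X := (ord0, x).
have f_def := definable_comp h (definable_sat f).
apply: (a_like_c 1%N _ f_def _ (fun=> i)) => [s _|k l].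
  exact: (c_p (s ord0) f pf).
by rewrite (ord1 k) (ord1 l) ltxx.
Qed.

Variables (d : Order.disp_t) (W : orderType d) (X : Type).

Lemma indiscernible_subset (D D' : set W) (B B' : set M) (a : W -> X -> M) :
  D' `<=` D -> B' `<=` B -> indiscernible D B a -> indiscernible D' B' a.
Proof.
move=> D'D B'B a_ind n s t sD' tD' s_incr t_incr; apply: same_type_subset B'B _.
by apply: a_ind => // k; apply: D'D.
Qed.

Lemma indiscernible_preimage (f : W -> W) (D : set W) (B : set M)
    (a : W -> X -> M) :
  increasing f -> indiscernible D B a -> indiscernible (f @^-1` D) B (a \o f).
Proof.
move=> f_incr a_ind n s t sD tD s_incr t_incr.
by apply: (a_ind n (f \o s) (f \o t)) => // k l kl; apply: f_incr;
  [apply: s_incr|apply: t_incr].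
Qed.

Lemma indiscernible_image (f : W -> W) (D : set W) (B : set M)
    (a : W -> X -> M) :
  increasing f -> indiscernible D B (a \o f) -> indiscernible (f @` D) B a.
Proof.
move=> f_incr af_ind n s t sD tD s_incr t_incr.
have lift_seq (u : 'I_n -> W) : (forall k, (f @` D) (u k)) -> increasing u ->
    exists u' : 'I_n -> W, [/\ forall k, D (u' k), f \o u' = u & increasing u'].
  move=> uD u_incr; have /choice[u' u'P] k : exists i, D i /\ f i = u k.
    by have [i] := uD k; exists i.
  exists u'; split=> [k||k l kl]; first exact: (u'P k).1.
    by apply: funext => k; exact: (u'P k).2.
  have := u_incr _ _ kl; rewrite -(u'P k).2 -(u'P l).2.
  by rewrite (leW_mono (le_mono f_incr)).
have [s' [s'D <- s'_incr]] := lift_seq s sD s_incr.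
have [t' [t'D <- t'_incr]] := lift_seq t tD t_incr.
exact: (af_ind n s' t').
Qed.

End Indiscernible.

Section ModelingProperty.
Variables (L : language) (M : structure L) (S : Type).
Hypotheses (nat_lt : card_lt nat S) (M_sat : is_saturated M S).
Variables (A : set M) (X : Type) (d : Order.disp_t) (W : orderType d).
Hypotheses (A_lt : card_lt A S) (X_lt : card_lt X S) (W_lt : card_lt W S).
Variable c : nat -> X -> M.

(* One instance of the indiscernibility of a sequence indexed by [W], together
   with one instance of its realizing the EM-type of [c]. *)
Record comparison := Comparison {
  cmp_length : nat;
  cmp_left : 'I_cmp_length -> W;
  cmp_right : 'I_cmp_length -> W;
  cmp_pred : ('I_cmp_length * X -> M) -> Prop
}.

Arguments cmp_left : clear implicits.
Arguments cmp_right : clear implicits.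
Arguments cmp_pred : clear implicits.

Definition comparison_valid (q : comparison) : Prop :=
  [/\ increasing (cmp_left q), increasing (cmp_right q)
    & definable A (cmp_pred q)].

Definition comparison_holds (q : comparison) (e : W * X -> M) : Prop :=
  let P s := cmp_pred q (along (fun i x => e (i, x)) s) in
  (P (cmp_left q) <-> P (cmp_right q)) /\
  ((forall s : 'I_(cmp_length q) -> nat, increasing s ->
      cmp_pred q (along c s)) -> P (cmp_left q)).

Lemma comparison_definable q :
  comparison_valid q -> definable A (comparison_holds q).
Proof.
move=> [_ _ P_def].
have along_def (s : 'I_(cmp_length q) -> W) :
    definable A (fun e => cmp_pred q (along (fun i x => e (i, x)) s)).
  exact: definable_comp (fun v => (s v.1, v.2)) P_def.
apply: definable_and; first exact: definable_iff.
exact/definable_imp/along_def/definable_cst.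
Qed.

Lemma comparison_subsequence q (r : W -> nat) (h : nat -> nat) :
  increasing (r \o cmp_left q) -> increasing (r \o cmp_right q) ->
  increasing h -> homogeneous (fun s => cmp_pred q (along c s)) h ->
  comparison_holds q (fun z => c (h (r z.1)) z.2).
Proof.
move=> left_incr right_incr h_incr h_hom.
split; first exact: h_hom left_incr right_incr.
move=> /(_ (h \o (r \o cmp_left q))); apply=> i j ij; apply: h_incr.
exact: left_incr.
Qed.

(* Ramsey's theorem makes finite parts of the conditions hold along a
   subsequence of [c]; compactness does the rest. *)
Lemma exists_indiscernible_realizing_EM :
  exists2 a : W -> X -> M, indiscernible setT A a & realizes_EM A c a.
Proof.
have [|_ [q q_valid <-]|F0 F0F F0_fin|e eP] := realize_definable nat_lt M_sat
    (V := W * X) (A := A) (F := comparison_holds @` comparison_valid) _ A_lt.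
- exact: card_lt_prod.
- exact: comparison_definable.
- have [Q [Q_fin Q_valid ->]] := finite_sub_image F0_fin F0F.
  pose K := \bigcup_(q in Q) (range (cmp_left q) `|` range (cmp_right q)).
  have K_fin : finite_set K.
    apply: bigcup_finite => // q _; rewrite finite_setU.
    by split; exact: finite_image.
  have [r r_incr] := finite_set_increasing_index K_fin.
  have r_comp_incr n (s : 'I_n -> W) :
      range s `<=` K -> increasing s -> increasing (r \o s).
    by move=> sK s_incr i j /s_incr; apply: r_incr; apply/mem_set/sK; eexists.
  pose ramsey_pred q : {n & set ('I_n -> nat)} :=
    existT _ _ (fun s => cmp_pred q (along c s)).
  have [h h_incr h_hom] :=
    ramsey_finite_family (finite_image ramsey_pred Q_fin).
  exists (fun z => c (h (r z.1)) z.2) => _ [q Qq <-].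
  have [left_incr right_incr _] := Q_valid q Qq.
  have left_K : range (cmp_left q) `<=` K.
    by move=> w qw; exists q => //; left.
  have right_K : range (cmp_right q) `<=` K.
    by move=> w qw; exists q => //; right.
  apply: comparison_subsequence h_incr _.
  + exact: r_comp_incr left_K left_incr.
  + exact: r_comp_incr right_K right_incr.
  + by apply: (h_hom (ramsey_pred q)); exists q.
have e_holds q : comparison_valid q -> comparison_holds q e.
  by move=> ?; apply: eP; exists q.
exists (fun i x => e (i, x)) => [n s t _ _ s_incr t_incr|n P P_def Pc s s_incr].
  by apply/same_typeP => P P_def; have [] := e_holds (Comparison s t P).
by have [//|_] := e_holds (Comparison s s P); apply.
Qed.

End ModelingProperty.

(** * Shattering *)

Section Shattering.
Variables (L : language) (M : structure L) (S : Type).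
Hypothesis nat_lt : card_lt nat S.

Definition shattered (U I X : Type) (P : (U + X -> M) -> Prop)
    (c : I -> X -> M) : Prop :=
  forall E D : set I, finite_set D ->
  exists y, forall i, D i -> P (join_env y (c i)) <-> E i.

Section Realization.
Hypothesis M_sat : is_saturated M S.
Variables (A : set M) (U X : Type) (P : (U + X -> M) -> Prop).
Hypotheses (A_lt : card_lt A S) (U_lt : card_lt U S) (X_lt : card_lt X S)
  (P_def : definable A P).

Lemma shattered_realize (I : Type) (c : I -> X -> M) :
  card_lt I S -> shattered P c ->
  forall E : set I, exists y, forall i, P (join_env y (c i)) <-> E i.
Proof.
move=> I_lt c_shattered E.
pose B := A `|` range (fun z => c z.1 z.2).
have B_lt : card_lt B S.
  by apply: card_lt_setU => //; apply: card_lt_range; exact: card_lt_prod.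
have cB i : A `|` range (c i) `<=` B.
  by move=> m [Am|[x _ <-]]; [left|right; exists (i, x)].
pose F := range (fun i y => P (join_env y (c i)) <-> E i).
have [_ [i _ <-] /=|F0 F0_sub F0_fin|y yF] :=
  realize_definable nat_lt M_sat U_lt B_lt (F := F).
- apply: definable_iff; last exact: definable_cst.
  exact: definable_subset (cB i) (definable_join_envr (c i) P_def).
- have [D [D_fin _ ->]] := finite_sub_image F0_fin F0_sub.
  by have [y yP] := c_shattered E D D_fin; exists y => _ [i Di <-]; exact: yP.
by exists y => i; apply: (yF (fun y => P (join_env y (c i)) <-> E i)); exists i.
Qed.

End Realization.

Lemma realizes_EM_shattered (A : set M) (U X : Type) (P : (U + X -> M) -> Prop)
    (d d' : Order.disp_t) (I : orderType d) (W : orderType d')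
    (c : I -> X -> M) (a : W -> X -> M) :
  realizes_EM A c a -> definable A P -> shattered P c -> shattered P a.
Proof.
move=> a_like_c P_def c_shattered E D D_fin.
have [n [s [s_incr Ds]]] := finite_set_increasing D_fin.
pose h (k : 'I_n) (w : U + X) : U + 'I_n * X :=
  match w with inl u => inl u | inr x => inr (k, x) end.
have hE (J : Type) (b : J -> X -> M) (t : 'I_n -> J) y k :
    join_env y (along b t) \o h k = join_env y (b (t k)).
  by apply: funext => -[].
pose pattern k (z : U + 'I_n * X -> M) := P (z \o h k) <-> E (s k).
have pattern_def : definable A (fun z => forall Q, range pattern Q -> Q z).
  apply: definable_finite_forall => [|_ [k _ <-]]; first exact: finite_image.
  by apply: definable_iff; [exact: definable_comp|exact: definable_cst].
have [t t_incr|y yE] :=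
    a_like_c n _ (definable_exists_join_env pattern_def) _ s s_incr.
  have t_inj : injective t := inc_inj (le_mono t_incr).
  have [y yE] := c_shattered [set i | exists2 k, t k = i & E (s k)] (range t)
    (finite_image t finite_finset).
  exists y => _ [k _ <-]; rewrite /pattern hE yE; last by exists k.
  by split=> [[l /t_inj -> //]|Ek]; exists k.
exists y => i /Ds[k _ <-].
by have := yE (pattern k) (imageP pattern Logic.I); rewrite /pattern hE.
Qed.

Section Flipping.
Hypothesis M_hom : is_strongly_homogeneous M S.
Variables (A : set M) (X : Type) (p : set (formula L (X + A))).
Hypothesis A_lt : card_lt A S.

Lemma strongly_homogeneous_over (V : Type) (e e' : V -> M) : card_lt V S ->
  same_type A e e' -> exists s, [/\ is_automorphism s,
    forall a, A a -> s a = a & s \o e = e'].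
Proof.
move=> V_lt /same_typeP ee'.
have [|s s_auto se] :=
    M_hom (card_lt_sum nat_lt V_lt A_lt) (e := env e) (e' := env e').
  apply/same_typeP => P /(definable_subst id (@sub0set _ A)); exact: ee'.
exists s; split=> // [a Aa|]; first exact: se (inr (SigSub (mem_set Aa))).
by apply: funext => v; exact: se (inl v).
Qed.

Definition mutually_flippable (K U : Type) (y : K -> bool -> U -> M) : Prop :=
  forall k, same_type
    (A `|` \bigcup_(l in [set l | l <> k]) \bigcup_b range (y l b))
    (y k true) (y k false).

Section Flip.
Variables (K U : Type) (y : K -> bool -> U -> M).
Hypothesis y_flip : mutually_flippable y.

Definition select (eta : K -> bool) (z : K * U) : M := y z.1 (eta z.1) z.2.

Lemma select_flip1 (k : K) (eta eta' : K -> bool) :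
  (forall l, l <> k -> eta l = eta' l) ->
  same_type A (select eta) (select eta').
Proof.
move=> eta_eq; apply/same_typeP => P P_def.
have := @y_flip k; set B := A `|` _ => /same_typeP flip.
have select_B z : z.1 <> k -> B (select eta z).
  by move=> zk; right; exists z.1 => //; exists (eta z.1) => //; exists z.2.
pose h (z : K * U) : U + B := if pselect (z.1 <> k) is left zk
  then inr (SigSub (mem_set (select_B z zk))) else inl z.2.
have hE eta1 : (forall l, l <> k -> eta l = eta1 l) ->
    env (y k (eta1 k)) \o h = select eta1.
  move=> eta1E; apply: funext => z; rewrite /= /h /select.
  by case: pselect => /= [/eta1E ->|/contrapT ->].
have {flip} := flip _ (definable_subst h (@subsetUl _ _ _) P_def).
rewrite -(hE eta) // -(hE eta') //.
by case: (eta k); case: (eta' k) => // ->.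
Qed.

Lemma select_same_type (eta eta' : K -> bool) :
  same_type A (select eta) (select eta').
Proof.
apply/same_typeP => P P_def.
have [D [D_fin DP]] := definable_finite_support P_def.
pose mix (F : set K) k := if pselect (F k) is left _ then eta' k else eta k.
have mixP (F : set K) : finite_set F -> P (select eta) <-> P (select (mix F)).
  move: F; apply: finite_set_ind => [|k F _ ->].
    rewrite (_ : mix set0 = eta) //; apply: funext => k.
    by rewrite /mix; case: pselect.
  suff /same_typeP : same_type A (select (mix F)) (select (mix (k |` F))).
    exact.
  apply: (@select_flip1 k) => l lk; rewrite /mix.
  case: pselect => Fl; case: pselect => // kFl; first by case: kFl; right.
  by case: kFl.
rewrite (mixP (fst @` D)); last exact: finite_image.
by apply: DP => z Dz; rewrite /select /mix; case: pselect => // -[]; exists z.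
Qed.

Lemma exists_realization_of_pattern (c : X -> M) (P : (U + X -> M) -> Prop)
    (eta : K -> bool) :
  card_lt K S -> card_lt U S -> realizes p c -> definable A P ->
  (forall k b, P (join_env (y k b) c) <-> b) ->
  exists2 c', realizes p c' & forall k, P (join_env (y k true) c') <-> eta k.
Proof.
move=> K_lt U_lt c_p P_def yP.
have [s [s_auto sA s_select]] :=
  strongly_homogeneous_over (card_lt_prod nat_lt K_lt U_lt)
    (select_same_type eta xpredT).
exists (s \o c) => [f pf|k].
  exact/(automorphism_definable c s_auto sA (definable_sat f))/c_p.
rewrite (_ : join_env _ _ = s \o join_env (y k (eta k)) c).
  by rewrite (automorphism_definable _ s_auto sA P_def).
apply: funext => -[u|//]; exact: esym (congr1 (@^~ (k, u)) s_select).
Qed.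

End Flip.

(* [c' i] is chosen so that [P (join_env (y l true) (c' i))] holds exactly when
   [i] is in the [l]-th finite set of naturals. *)
Lemma dual_shattered (U : Type) (y : nat -> bool -> U -> M) (c : X -> M)
    (P : (U + X -> M) -> Prop) :
  mutually_flippable y -> card_lt U S -> realizes p c -> definable A P ->
  (forall k b, P (join_env (y k b) c) <-> b) ->
  exists2 c' : nat -> X -> M, forall i, realizes p (c' i) & shattered P c'.
Proof.
move=> y_flip U_lt c_p P_def yP.
pose eta i l := i \in odflt [::] (unpickle l : option (seq nat)).
have /choice[c' c'P] i : exists c', realizes p c' /\
    forall l, P (join_env (y l true) c') <-> eta i l.
  have [c' ? ?] :=
    exists_realization_of_pattern y_flip (eta i) nat_lt U_lt c_p P_def yP.
  by exists c'.
exists c' => [i|E D D_fin]; first exact: (c'P i).1.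
have /finite_seqP[s sE] : finite_set (D `&` E) by exact: finite_setIl.
exists (y (pickle s) true) => i Di; rewrite (c'P i).2 /eta pickleK /=.
have <- : (D `&` E) i = (i \in s) by rewrite sE.
by split=> [[]|].
Qed.

End Flipping.
End Shattering.

Section UnboundedRank.
Variables (L : language) (M : structure L).

Lemma not_indiscernible_witness (d : Order.disp_t) (I : orderType d)
    (J X : Type) (A B : set M) (c : X -> M) (a : I -> J -> M) :
  indiscernible setT B a -> ~ indiscernible setT (A `|` range c) a ->
  exists (P : (nat + X -> M) -> Prop) (y : bool -> nat -> M),
    [/\ definable A P, forall b, P (join_env (y b) c) <-> b,
        same_type B (y true) (y false)
      & forall b, range (y b) `<=` \bigcup_i range (a i)].
Proof.
move=> a_ind a_not_ind.
have [n [s [Q [s_incr Q_def Qs]]]] : exists n (s : bool -> 'I_n -> I) Q,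
    [/\ forall b, increasing (s b), definable (A `|` range c) Q
      & forall b, Q (along a (s b)) <-> b].
  apply: contrapT => none; apply: a_not_ind => n s t _ _ s_incr t_incr.
  apply/same_typeP => Q Q_def.
  split=> [Qs|Qt]; apply: contrapT => nQ; apply: none.
    by exists n, (fun b => if b then s else t), Q; split=> // -[].
  by exists n, (fun b => if b then t else s), Q; split=> // -[].
have [v0 _] : [set: 'I_n * J] !=set0.
  apply: contrapT => /set0P/negP/negPn/eqP V0.
  have eq_along : along a (s true) = along a (s false).
    by apply: funext => v; have : [set: 'I_n * J] v by []; rewrite V0.
  by have := Qs false; rewrite -eq_along (Qs true) => -[/(_ isT)].
have [P P_def PQ] := definable_range_params Q_def.
have [D [D_fin DP]] := definable_finite_support P_def.
have DV_fin : finite_set (inl @^-1` D).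
  by apply: finite_preimage => // ? ? _ _ [].
have [vs [k kP]] := finite_set_nth v0 DV_fin.
pose h (z : 'I_n * J + X) : nat + X :=
  match z with inl v => inl (k v) | inr x => inr x end.
exists (fun e => P (e \o h)), (fun b => along a (s b) \o nth v0 vs); split.
- exact: definable_comp.
- by move=> b; rewrite -Qs PQ; apply: DP => -[v|//] Dv /=; rewrite kP.
- by apply: same_type_comp; exact: a_ind.
- by move=> b _ [m _ <-]; do 2?eexists.
Qed.

Lemma not_rk_dp_lt_shattered (S K X : Type) (A : set M)
    (p : set (formula L (X + A))) :
  card_lt nat S -> is_strongly_homogeneous M S -> card_lt A S ->
  ~ ([set: K] #<= [set: formula L nat * seq (nat + X + A)]) ->
  ~ rk_dp_lt S K p ->
  exists (P : (nat + X -> M) -> Prop) (c : nat -> X -> M),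
    [/\ definable A P, forall i, realizes p (c i) & shattered P c].
Proof.
move=> nat_lt M_hom A_lt K_large; apply: contra_notP => not_shattered.
move=> c c_p d I J a _ _ a_mut; apply: contrapT => no_ind.
pose B k := A `|` \bigcup_(l in [set l | l <> k]) \bigcup_i range (a l i).
have /choice[Py PyP] (k : K) :
    exists Py : ((nat + X -> M) -> Prop) * (bool -> nat -> M),
    [/\ definable A Py.1, forall b, Py.1 (join_env (Py.2 b) c) <-> b,
        same_type (B k) (Py.2 true) (Py.2 false)
      & forall b, range (Py.2 b) `<=` \bigcup_i range (a k i)].
  have [|P [y yP]] := not_indiscernible_witness (A := A) (c := c) (a_mut k).
    by move=> k_ind; apply: no_ind; exists k.
  by exists (P, y).
have /choice[code codeP] k : exists q : formula L nat * seq (nat + X + A),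
    forall e, (Py k).1 e <-> sat (env e \o nth (inl (inl 0%N)) q.2) q.1.
  by have [P_def _ _ _] := PyP k; exact: definable_code.
have code_inf : infinite_set [set: formula L nat * seq (nat + X + A)].
  apply/infiniteP; apply: card_le_trans (card_nat_le_formula L) _.
  by apply/card_leTP; exists (fun f => (f, [::])) => f g [].
have [q /infiniteP fiber_inf] := infinite_fiber code code_inf K_large.
have [|k k_code k_inj] := card_le_fun fiber_inf; first by exists 0%N.
have PE l : (Py (k l)).1 = (Py (k 0%N)).1.
  by apply/funext => e; apply/propext; rewrite !codeP !k_code.
have [P_def _ _ _] := PyP (k 0%N).
have [|l b|c' c'_p c'_shattered] := dual_shattered nat_lt M_hom A_lt
    (y := fun l => (Py (k l)).2) _ nat_lt c_p P_def.
- move=> l; have [_ _ + _] := PyP (k l); apply: same_type_subset.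
  move=> x [Ax|[m ml [b _ xb]]]; [by left|right].
  have [_ _ _ /(_ b x xb)[i _ xi]] := PyP (k m).
  exists (k m); last by exists i.
  by move=> /k_inj; rewrite !inE => /(_ Logic.I Logic.I).
- by rewrite -(PE l); have [_ + _ _] := PyP (k l); apply.
by apply: not_shattered; exists (Py (k 0%N)).1, c'.
Qed.

Lemma not_dependent_shattered (S X : Type) (A : set M)
    (p : set (formula L (X + A))) :
  is_limit_card S -> card_lt nat S -> card_lt (card_theory L) S ->
  is_strongly_homogeneous M S -> card_lt A S -> card_lt X S ->
  ~ dependent S p ->
  exists (P : (nat + X -> M) -> Prop) (c : nat -> X -> M),
    [/\ definable A P, forall i, realizes p (c i) & shattered P c].
Proof.
move=> S_lim nat_lt T_lt M_hom A_lt X_lt p_indep.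
have code_lt : card_lt (formula L nat * seq (nat + X + A)) S.
  by do ?[apply: card_lt_prod|apply: card_lt_seq|apply: card_lt_sum].
have [K [_ K_large] K_lt] := S_lim _ code_lt.
apply: not_rk_dp_lt_shattered nat_lt M_hom A_lt K_large _ => rk_K.
by apply: p_indep; exists K.
Qed.

End UnboundedRank.

(** * Tails *)

Section Tails.
Variables (L : language) (M : structure L) (A : set M) (X : Type).
Variables (p : set (formula L (X + A))) (d : Order.disp_t) (W : orderType d).
Hypotheses (W_ord : is_initial_ordinal W) (W_inf : infinite_set [set: W]).
Hypothesis tail_indiscernible :
  forall A' : set M, A `<=` A' -> finite_set (A' `\` A) ->
  forall a : W -> X -> M, (forall i, realizes p (a i)) ->
    indiscernible setT A' a ->
  forall c : M, exists alpha : W,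
    indiscernible [set i | (alpha < i)%O] (A' `|` [set c]) a.

(* The tail is reindexed by the whole of [W] before a parameter is added. *)
Lemma tail_indiscernible_finite (C : set M) : finite_set C ->
  forall A' : set M, A `<=` A' -> finite_set (A' `\` A) ->
  forall a : W -> X -> M, (forall i, realizes p (a i)) ->
    indiscernible setT A' a ->
  exists alpha : W, indiscernible [set i | (alpha < i)%O] (A' `|` C) a.
Proof.
move: C; apply: finite_set_ind => [|c C _ IH] A' AA' A'_fin a a_p a_ind.
  have [alpha _] := infinite_setN0 W_inf; exists alpha.
  by rewrite setU0; apply: indiscernible_subset a_ind.
have [alpha a_ind_c] := tail_indiscernible AA' A'_fin a_p a_ind c.
have [f [f_incr f_range]] := initial_ordinal_tail_iso W_ord W_inf alpha.
have f_gt i : (alpha < f i)%O.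
  by have : range f (f i) by [exists i]; rewrite f_range.
have [x Ax||i|//|beta af_ind] := IH (A' `|` [set c]) _ _ (a \o f).
- by left; exact: AA'.
- rewrite setDUl finite_setU; split=> //.
  by apply: finite_setD; exact: finite_set1.
- exact: a_p.
- apply: indiscernible_subset (indiscernible_preimage f_incr a_ind_c) => // i _.
  exact: f_gt.
exists (f beta).
apply: indiscernible_subset (indiscernible_image f_incr af_ind) => [j /= j_gt|].
  have [i _ fij] : range f j by rewrite f_range; exact: lt_trans j_gt.
  by exists i => //=; rewrite -(leW_mono (le_mono f_incr)) fij.
by rewrite setUA.
Qed.

Lemma eventually_constant (U : Type) (P : (U + X -> M) -> Prop) (y : U -> M)
    (a : W -> X -> M) :
  definable A P -> (forall i, realizes p (a i)) -> indiscernible setT A a ->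
  exists alpha : W, forall i j, (alpha < i)%O -> (alpha < j)%O ->
    P (join_env y (a i)) <-> P (join_env y (a j)).
Proof.
move=> P_def a_p a_ind; have [D [D_fin DP]] := definable_finite_support P_def.
have [m0] := carrier_inhabited M.
pose y' u := if pselect (D (inl u)) is left _ then y u else m0.
have y'P e : P (join_env y e) <-> P (join_env y' e).
  by apply: DP => -[u|//] Du /=; rewrite /y'; case: pselect.
have y'_fin : finite_set (range y').
  apply: (@sub_finite_set _ _ (m0 |` y @` (inl @^-1` D))).
    move=> _ [u _ <-]; rewrite /y'.
    by case: pselect => Du; [right; exists u|left].
  rewrite finite_setU; split; first exact: finite_set1.
  by apply/finite_image/finite_preimage => // ? ? _ _ [].
have [|alpha a_tail] :=
    tail_indiscernible_finite y'_fin (@subset_refl _ A) _ a_p a_ind.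
  by rewrite setDv.
exists alpha => i j alpha_i alpha_j; rewrite !y'P.
pose h (x : X) : 'I_1 * X := (ord0, x).
have P'_def := definable_comp h (definable_join_envl y' P_def).
have one_incr (k : W) : increasing (fun _ : 'I_1 => k).
  by move=> ? ?; rewrite !ord1 ltxx.
have /same_typeP/(_ _ P'_def) := a_tail 1%N (fun=> i) (fun=> j)
  (fun=> alpha_i) (fun=> alpha_j) (one_incr i) (one_incr j).
exact.
Qed.

End Tails.

Lemma card_lt_succ (S K Y : Type) :
  is_limit_card S -> is_succ_card K Y -> card_lt Y S -> card_lt K S.
Proof.
by move=> S_lim [_ K_min] /S_lim[Z /K_min KZ]; exact: card_le_lt_trans.
Qed.

Theorem theorem2p9
  (L : language) (T : set (sentence L)) (hT : is_complete T)
  (S : Type) (C : structure L) (hC : is_monster_model T S C)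
  (A : set C) (hA : card_lt A S)
  (X : Type) (hX : card_lt X S)
  (p : set (formula L (X + A))) (hp : is_partial_type p)
  (* KT = |T|^+, KA = |A|^+, and W is the initial ordinal |T|^+ + |A|^+ *)
  (KT : Type) (hKT : is_succ_card KT (card_theory L))
  (KA : Type) (hKA : is_succ_card KA A)
  (d : Order.disp_t) (W : orderType d) (hW : is_initial_ordinal W)
  (hcardW : [set: W] #= [set: (KT + KA)%type])
  (h : forall A' : set C, A `<=` A' -> finite_set (A' `\` A) ->
       forall a : W -> X -> C, (forall i, realizes p (a i)) ->
       indiscernible setT A' a ->
       forall c : C, exists alpha : W,
         indiscernible [set i | (alpha < i)%O] (A' `|` [set c]) a) :
  dependent S p.
Proof.
have [_ S_lim T_lt C_sat C_hom] := hC.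
have nat_T : [set: nat] #<= [set: card_theory L] by exact: card_nat_le_formula.
have nat_lt : card_lt nat S by exact: card_le_lt_trans T_lt.
move: hcardW; rewrite card_eq_le => /andP[W_le W_ge].
have W_lt : card_lt W S.
  apply: card_le_lt_trans W_le _.
  by apply: card_lt_sum; [|exact: card_lt_succ hKT _|exact: card_lt_succ hKA _].
have W_inf : infinite_set [set: W].
  apply/infiniteP; apply: card_le_trans nat_T (card_le_trans hKT.1.1 _).
  by apply: card_le_trans W_ge; apply/card_leTP; exists inl => x y [].
apply: contrapT => p_indep; have [P [c [P_def c_p c_shattered]]] :=
  not_dependent_shattered S_lim nat_lt T_lt C_hom hA hX p_indep.
have [a a_ind a_like_c] :=
  exists_indiscernible_realizing_EM nat_lt C_sat hA hX W_lt c.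
have a_p := realizes_EM_realizes a_like_c c_p.
have a_shattered := realizes_EM_shattered a_like_c P_def c_shattered.
have [E E_bicofinal] := initial_ordinal_bicofinal_set hW W_inf.
have [y yE] :=
  shattered_realize nat_lt C_sat hA nat_lt hX P_def W_lt a_shattered E.
have [alpha alphaP] := eventually_constant hW W_inf h y P_def a_p a_ind.
have [[i alpha_i Ei] [j alpha_j nEj]] := E_bicofinal alpha.
by apply: nEj; apply/yE/(alphaP i j alpha_i alpha_j)/yE.
Qed.
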